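(* For any positive integers $k,d,t,D$ there exists a constant $c=c(k,d,t,D)>0$ with the following property. Let $0<\varepsilon<1/2$ and let $H=(P,E)$ be a $k$-uniform semi-algebraic hypergraph in $\mathbb{R}^d$ with complexity $(t,D)$. Then $P$ has an equitable partition $P=P_1\cup\cdots\cup P_K$ into $K\le(1/\varepsilon)^c$ parts such that all but an $\varepsilon$-fraction of the $k$-tuples of parts $(P_{i_1},\dots,P_{i_k})$ are homogeneous.
   Context: A $k$-uniform hypergraph $H=(P,E)$ has a finite vertex set $P$ and a set $E$ of $k$-element subsets of $P$; $E$ is regarded as a symmetric relation, i.e. $(p_1,\dots,p_k)\in E$ means $\{p_1,\dots,p_k\}\in E$. $H=(P,E)$ with $P=\{p_1,\dots,p_n\}\subset\mathbb{R}^d$ is semi-algebraic in $\mathbb{R}^d$ with complexity $(t,D)$ if there are polynomials $f_1,\dots,f_t\in\mathbb{R}[x_1,\dots,x_{kd}]$ (viewed as functions of $k$ points of $\mathbb{R}^d$) and a Boolean function $\Phi$ such that for every $1\le i_1<\cdots<i_k\le n$: $(p_{i_1},\dots,p_{i_k})\in E$ if and only if for all permutations $\pi$ of the indices, $\Phi\big(f_1(p_{\pi(i_1)},\dots,p_{\pi(i_k)})\ge0,\dots,f_t(p_{\pi(i_1)},\dots,p_{\pi(i_k)})\ge0\big)=1$; and, for every $1\le j\le t$ and any fixed $q_1,\dots,q_{k-1}\in\mathbb{R}^d$, each of the $k$ $d$-variate polynomials $f_j(\mathbf{x},q_1,\dots,q_{k-1}),\ f_j(q_1,\mathbf{x},q_2,\dots,q_{k-1}),\dots,f_j(q_1,\dots,q_{k-1},\mathbf{x})$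 has degree at most $D$. A partition is equitable if any two parts differ in size by at most one. A $k$-tuple of vertex sets $(P_{i_1},\dots,P_{i_k})$ is homogeneous if either $P_{i_1}\times\cdots\times P_{i_k}\subseteq E$ or $(P_{i_1}\times\cdots\times P_{i_k})\cap E=\emptyset$. The $k$-tuples of parts are indexed by $k$-tuples $(i_1,\dots,i_k)$ of indices in $\{1,\dots,K\}$. *)

(* Defs.v *)
From HB Require Import structures.
From mathcomp Require Import all_boot all_order all_algebra all_fingroup.
From mathcomp Require Import mpoly.
From mathcomp Require Import reals.

Set Implicit Arguments.
Unset Strict Implicit.
Unset Printing Implicit Defensive.

Import Order.TTheory GRing.Theory Num.Theory.
Local Open Scope ring_scope.

Record hypergraph (k : nat) (V : finType) := Hypergraph {
  edges : {set {set V}};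
  edges_uniform : {in edges, forall e : {set V}, #|e| = k}
}.

(* The edge set as a symmetric k-ary relation.  A tuple with a repeated vertex
   never belongs to it, since its image has fewer than k elements. *)
Definition edge_rel (k : nat) (V : finType) (H : hypergraph k V) :
    {set {ffun 'I_k -> V}} :=
  [set x : {ffun 'I_k -> V} | [set x l | l : 'I_k] \in edges H].

(* [family A] is the product A 0 * ... * A (k - 1). *)
Definition homogeneous (k : nat) (V : finType) (H : hypergraph k V)
    (A : 'I_k -> {set V}) : bool :=
  (family A \subset edge_rel H) || [disjoint family A & edge_rel H].

(* [partition] forces the parts to be nonempty, and injectivity of Q makes K
   their exact number. *)
Definition equitable_partition (V : finType) (K : nat)
    (Q : 'I_K -> {set V}) : Prop :=
  [/\ partition [set Q i | i : 'I_K] [set: V],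
      injective Q
    & forall i j, (#|Q i| <= #|Q j| + 1)%N].

Section SemiAlgebraic.
Variables (R : realType) (k d : nat).

(* f (x_1, ..., x_k) for f in k * d variables; coordinate s of the point x_l is
   substituted for the variable of index [mxvec_index l s]. *)
Definition eval_points (f : {mpoly R[k * d]}) (x : 'I_k -> 'rV[R]_d) : R :=
  f.@[mxvec (\matrix_(l < k) x l) 0].

(* The d-variate polynomial f (q_1, ..., q_(m-1), X, q_m, ..., q_(k-1)), the
   point X of indeterminates being inserted in slot m. *)
Definition slot_poly (f : {mpoly R[k * d]}) (m : 'I_k)
    (q : 'I_k.-1 -> 'rV[R]_d) : {mpoly R[d]} :=
  let args : 'M[{mpoly R[d]}]_(k, d) := \matrix_(l < k, s < d)
    if unlift m l is Some l' then (q l' 0 s)%:MP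
    else 'X_s in
  f \mPo [tuple mxvec args 0 a | a < k * d].

(* [msize] is one more than the total degree, and 0 for the zero
   polynomial. *)
Definition semi_algebraic (t D n : nat) (p : 'I_n -> 'rV[R]_d)
    (H : hypergraph k 'I_n) : Prop :=
  exists (f : 'I_t -> {mpoly R[k * d]}) (Phi : t.-tuple bool -> bool),
    (forall i : {ffun 'I_k -> 'I_n},
       {homo i : a b / (a < b)%N} ->
       i \in edge_rel H <->
       forall pi : 'S_k,
         Phi [tuple 0 <= eval_points (f j) (fun l => p (i (pi l))) | j < t]) /\
    (forall (j : 'I_t) (m : 'I_k) (q : 'I_k.-1 -> 'rV[R]_d),
       (msize (slot_poly (f j) m q) <= D.+1)%N).

End SemiAlgebraic.

(* Main.v *)
Require Import Defs.
From HB Require Import structures.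
From mathcomp Require Import all_boot all_order all_algebra all_fingroup.
From mathcomp Require Import mpoly.
From mathcomp Require Import reals exp.
From mathcomp Require Import zify ring lra.

(** The degree condition bears on one point at a time, so each f_j is linear in
    the monomials of degree at most D of each of its points.  After this
    Veronese map only signs of multilinear forms on R^M are left, and the cells
    of all partitions can be cut out by finitely many linear functionals.  The
    partition is first sought for two points, then for k points, and made
    equitable only at the end.

    For two points, let x range over vectors and y over linear functionals.  It
    is enough to find boundedly many cuts on either side such that a constant
    proportion of the pairs (x, y) lies in products of cells on which the sign
    of y at x is constant: repeating this inside each product of cells where the
    sign varies leaves a proportion 2^-m of bad pairs after O(m) rounds, with
    2^O(m) cuts (lemma [strong_of_weak]).  The constant proportion is obtained by
    induction on the dimension M.  When the last coordinate eta of y is positive,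
    the sign of y at x tells whether the last coordinate of x reaches a threshold
    that depends only on y and on the other coordinates of x.  Comparing the
    thresholds of y1 and y2 is again a sign problem, in dimension M - 1, about x
    and the pair (y1, y2).  By the strong form of the lemma in dimension M - 1
    nearly all these comparisons are constant on cells, so some y0 of nearly
    middle rank compares in a constant way, over a large cell of x, with many y
    above it and many y below it.  Cutting the cell by y0 settles the sign
    against one of these two families (lemma [pivot]).

    For k points, a form is linear in the first point with coefficients that are
    forms in the other k - 1 points.  The bipartite lemma separates off the
    first point; the cuts that it makes on the other points are signs of forms
    in k - 1 points, to which induction applies (lemma
    [multipartite_regularity]).

    The number of cells is polynomial in the number of cuts, by the
    Sauer-Shelah bound (lemma [card_patterns]).  Listing the points cell by cell
    and chopping the list into K equal intervals gives the equitable partition,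
    since no more intervals than there are cells can meet several cells (lemma
    [equitable_refinement]).  A tuple of distinct intervals, each within
    one cell, can fail to be homogeneous only when all its point
    tuples are bad, and there are few bad tuples. *)

Set Implicit Arguments.
Unset Strict Implicit.
Unset Printing Implicit Defensive.

Import Order.TTheory GRing.Theory Num.Theory.
Local Open Scope ring_scope.

(** * Counting *)

Section Counting.
Local Open Scope nat_scope.

Lemma leq_expn (m n e : nat) : (m <= n)%N -> (m ^ e <= n ^ e)%N.
Proof. by case: e => // e le_mn; rewrite leq_exp2r. Qed.

Lemma size_flatten_le (T : Type) (I : eqType) (F : I -> seq T) (s : seq I) m :
  (forall i, i \in s -> size (F i) <= m)%N ->
  (size (flatten [seq F j | j <- s]) <= size s * m)%N.
Proof.
elim: s => //= j s IHs h; rewrite size_cat mulSn leq_add ?h ?mem_head //.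
by apply: IHs => i si; rewrite h // inE si orbT.
Qed.

Lemma leq_card_bigcup (T I : finType) (S : I -> {set T}) :
  #|\bigcup_i S i| <= \sum_i #|S i|.
Proof.
elim/big_rec2: _ => [|i a U _ le_aU]; first by rewrite cards0.
by apply: leq_trans (leq_card_setU _ _) _; rewrite leq_add2l.
Qed.

Lemma card_bounded_subsets (T : finType) (m : nat) :
  (#|[set S : {set T} | #|S| <= m]| <= #|T|.+1 ^ m)%N.
Proof.
rewrite -card_option -{2}(card_ord m) -card_ffun.
pose g (h : {ffun 'I_m -> option T}) := [set x | Some x \in codom h].
have := leq_imset_card g setT; rewrite cardsT; apply: leq_trans.
apply/subset_leq_card/subsetP => S; rewrite inE => leSm.
apply/imsetP; exists [ffun i : 'I_m => nth None [seq Some x | x <- enum S] i] => //.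
apply/setP => x; rewrite inE; apply/idP/codomP => [xS|[i]].
  have lti : (index x (enum S) < m)%N.
    by apply: leq_trans leSm; rewrite cardE index_mem mem_enum.
  exists (Ordinal lti); rewrite ffunE /= (nth_map x) ?nth_index ?mem_enum //.
  by rewrite index_mem mem_enum.
rewrite ffunE => eqx.
have lti : (i < size (enum S))%N.
  rewrite ltnNge; apply/negP => le_i.
  by move: eqx; rewrite nth_default ?size_map.
by move: eqx; rewrite (nth_map x) // => -[->]; rewrite -mem_enum mem_nth.
Qed.

Lemma card_fibers (T I : finType) (S : {set T}) (f : T -> I) :
  (#|S| = \sum_(i : I) #|[set x in S | f x == i]|)%N.
Proof.
rewrite -sum1_card (partition_big f predT) //=; apply: eq_bigr => i _.
by rewrite sum1dep_card; apply: eq_card => x; rewrite !inE.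
Qed.

(** Markov's inequality for the fiber sizes of f on S, at level c / q. *)
Lemma markov (T I : finType) (S : {set T}) (f : T -> I) c q :
  #|[set i | c <= q * #|[set x in S | f x == i]|]| * c <= q * #|S|.
Proof.
rewrite (card_fibers S f) big_distrr -sum_nat_const /=.
set big := [set i | _].
rewrite [X in _ <= X](bigID (mem big)) /=.
by apply: leq_trans (leq_addr _ _); apply: leq_sum => i; rewrite inE.
Qed.

Lemma pigeonhole (T I : finType) (S : {set T}) (f : T -> I) : 0 < #|S| ->
  exists2 x0, x0 \in S & #|S| <= #|I| * #|[set x in S | f x == f x0]|.
Proof.
rewrite card_gt0 => /set0Pn[x1 x1S].
pose F x := #|[set x' in S | f x' == f x]|.
case: (arg_maxnP F x1S) => x0 x0S max_x0; exists x0 => //.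
rewrite (card_fibers S f) -sum_nat_const; apply: leq_sum => i _.
have [->|[x]] := set_0Vmem [set x in S | f x == i]; first by rewrite cards0.
by rewrite inE => /andP[xS /eqP<-]; apply: max_x0.
Qed.

(** All elements of rank below a quarter lie below the largest of them, which
    itself has rank below a quarter. *)
Lemma few_low_ranks (R : realFieldType) (Y : finType) (g : Y -> R) (B : {set Y}) :
  4 * #|[set y in B | 4 * #|[set y1 in B | (g y1 <= g y)%R]| < #|B|]| <= #|B|.
Proof.
set low := [set y in B | _].
have [->|[y1 y1low]] := set_0Vmem low; first by rewrite cards0.
case: (arg_maxP (T := R) g y1low) => y ylow max_y.
have {}ylow : y \in low by [].
have yn : 4 * #|[set y1 in B | (g y1 <= g y)%R]| < #|B|.
  by move: ylow; rewrite inE => /andP[].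
apply: leq_trans (ltnW yn); rewrite leq_mul2l /=.
apply/subset_leq_card/subsetP => y' y'low.
rewrite inE [X in _ && X](max_y _ y'low) andbT.
by move: y'low; rewrite inE => /andP[].
Qed.

End Counting.

(** * Shattered sets *)

Section Shattering.
Local Open Scope nat_scope.
Variable T : finType.
Implicit Types (F : {set {set T}}) (S B E : {set T}).

Definition shatters F S :=
  [forall B : {set T}, (B \subset S) ==> [exists E in F, E :&: S == B]].

Lemma shattersP F S :
  reflect (forall B, B \subset S -> exists2 E, E \in F & E :&: S = B)
          (shatters F S).
Proof.
apply: (iffP forallP) => [h B sB|h B].
  by have /implyP/(_ sB)/exists_inP[E EF /eqP] := h B; exists E.
by apply/implyP => /h[E EF EB]; apply/exists_inP; exists E => //; apply/eqP.
Qed.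

Lemma shattersS F F' S : F \subset F' -> shatters F S -> shatters F' S.
Proof.
move=> sF /shattersP h; apply/shattersP => B /h[E EF EB].
by exists E => //; apply: (subsetP sF).
Qed.

(** Pajor's form of the Sauer-Shelah lemma.  Split F according to an element i
    on which two of its members differ.  A set shattered by one half avoids i,
    and if S is shattered by both halves then both S and S with i added are
    shattered by F; so the counts for the two halves add up. *)
Lemma card_shattered F : #|F| <= #|[set S | shatters F S]|.
Proof.
have [n] := ubnP #|F|; elim: n => // n IHn in F *; rewrite ltnS => leFn.
have [lt1F|] := ltnP 1 #|F|; last first.
  case: (set_0Vmem F) => [->|[E EF] leF1]; first by rewrite cards0.
  apply: leq_trans leF1 _; rewrite card_gt0; apply/set0Pn; exists set0.
  rewrite inE; apply/shattersP => B; rewrite subset0 => /eqP->.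
  by exists E; rewrite ?setI0.
have [E1 [E2 [E1F E2F neq12]]] : exists E1 E2, [/\ E1 \in F, E2 \in F & E1 != E2].
  by have /card_gt1P[E1 [E2 [? ? ?]]] := lt1F; exists E1, E2.
have [i iE] : exists i, (i \in E1) != (i \in E2).
  apply/existsP; apply: contraNT neq12 => /existsPn h.
  by apply/eqP/setP => i; have /negPn/eqP := h i.
pose Fb b := [set E in F | (i \in E) == b].
have sFb b : Fb b \subset F by apply/subsetP => E; rewrite inE => /andP[].
have cardF : #|F| = #|Fb true| + #|Fb false|.
  rewrite -(cardsID (Fb true) F) (setIidPr (sFb true)); congr (_ + _); apply: eq_card => E.
  by rewrite !inE; case: (E \in F) => //=; case: (i \in E).
have Fb_gt0 b : 0 < #|Fb b|.
  rewrite card_gt0; apply/set0Pn.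
  have [iE1|iE1] := eqVneq (i \in E1) b; first by exists E1; rewrite inE E1F iE1 /=.
  exists E2; rewrite inE E2F /=.
  by move: iE iE1; case: (i \in E1); case: (i \in E2); case: b.
have leb b : #|Fb b| <= #|[set S | shatters (Fb b) S]|.
  apply: IHn; move: (Fb_gt0 true) (Fb_gt0 false) leFn; rewrite cardF.
  by case: b; lia.
rewrite cardF; apply: leq_trans (leq_add (leb true) (leb false)) _.
set s1 := [set S | shatters (Fb true) S]; set s0 := [set S | shatters (Fb false) S].
have notin b S : shatters (Fb b) S -> i \notin S.
  move=> /shattersP h; apply/negP => iS.
  have [|E] := h (if b then set0 else [set i]).
    by case: b {h}; rewrite ?sub0set ?sub1set.
  rewrite inE => /andP[_ /eqP iEb] /setP/(_ i).
  by rewrite inE iEb iS; case: (b) => /=; rewrite inE ?eqxx.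
rewrite -cardsUI -(card_in_imset (f := fun S => i |: S) (D := s1 :&: s0)); last first.
  move=> S S'; rewrite !inE => /andP[/notin iS _] /andP[/notin iS' _] eqS.
  by rewrite -(setU1K iS) -(setU1K iS') eqS.
rewrite (_ : _ + _ = #|(s1 :|: s0) :|: [set i |: S | S in s1 :&: s0]|); last first.
  have := leq_card_setU (s1 :|: s0) [set i |: S | S in s1 :&: s0].
  move=> -[_ eqU]; apply/esym/eqP; rewrite eqU.
  rewrite disjoint_subset; apply/subsetP => S /setUP S10.
  rewrite inE; apply/imsetP => -[S' _ eqS].
  have: i \in S by rewrite eqS setU11.
  by apply/negP; case: S10; rewrite inE => /notin.
apply/subset_leq_card/subsetP => S /setUP[/setUP[]|/imsetP[S' /setIP[]]];
  rewrite !inE; try exact: shattersS.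
move=> /shattersP h1 /shattersP h0 ->; apply/shattersP => B sB.
(* adding i to S': whether a trace contains i decides which half realises it *)
have sB' : B :\ i \subset S' by rewrite subDset.
case/boolP: (i \in B) => iB.
  have [E EF EB] := h1 _ sB'; exists E; first exact: (subsetP (sFb _) _ EF).
  move: EF; rewrite inE => /andP[_ /eqP iE'].
  by rewrite setIUr EB (setIidPr _) ?sub1set ?setD1K.
have [E EF EB] := h0 _ sB'; exists E; first exact: (subsetP (sFb _) _ EF).
move: EF; rewrite inE => /andP[_ /eqP iE'].
rewrite setIUr EB (_ : E :&: [set i] = set0) ?set0U; last first.
  by apply/setP => j; rewrite !inE; case: eqP => [->|]; rewrite ?iE' ?andbF.
by apply/setDidPl; rewrite disjoint_sym disjoints1.
Qed.
End Shattering.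

(** * Sign patterns of linear functionals *)

Section Halfspaces.
Variable R : realFieldType.
Implicit Types (M : nat) (a b w : nat -> R) (W Z : seq (nat -> R)).

(** Vectors of R^M are functions on nat, of which the first M values count: the
    dimension can then be lowered by one without changing types. *)
Definition dot M a b : R := \sum_(s < M) a s * b s.
Definition pos M a b : bool := 0 <= dot M a b.
Definition same_side M W a b : bool :=
  [seq pos M a w | w <- W] == [seq pos M b w | w <- W].

Lemma eq_dot M a b b' : (forall s, (s < M)%N -> b s = b' s) ->
  dot M a b = dot M a b'.
Proof. by move=> h; apply: eq_bigr => s _; rewrite h. Qed.

Lemma same_side_refl M W a : same_side M W a a.
Proof. exact: eqxx. Qed.

Lemma same_side_sym M W a b : same_side M W a b = same_side M W b a.
Proof. exact: eq_sym. Qed.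

Lemma same_side_trans M W a b c :
  same_side M W a b -> same_side M W b c -> same_side M W a c.
Proof. by rewrite /same_side => /eqP->. Qed.

Lemma same_side_cons M w W a b :
  same_side M (w :: W) a b = (pos M a w == pos M b w) && same_side M W a b.
Proof. by rewrite /same_side /= eqseq_cons. Qed.

Lemma same_side_cat M W W' a b :
  same_side M (W ++ W') a b = same_side M W a b && same_side M W' a b.
Proof. by rewrite /same_side !map_cat eqseq_cat ?size_map. Qed.

Lemma same_side_flatten M (I : eqType) (F : I -> seq (nat -> R)) (s : seq I) i a b :
  i \in s -> same_side M (flatten [seq F j | j <- s]) a b -> same_side M (F i) a b.
Proof.
elim: s => // j s IHs; rewrite inE /= same_side_cat => /orP[/eqP->|/IHs h] /andP[] //.
Qed.

(** The classes of [same_side M W], in a form that can be counted. *)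
Definition pattern M W a : (size W).-tuple bool := map_tuple (pos M a) (in_tuple W).

Lemma same_side_pattern M W a b : same_side M W a b = (pattern M W a == pattern M W b).
Proof. by rewrite -val_eqE. Qed.

(** The negative coefficient serves to make a signed combination strictly
    positive. *)
Lemma dependent_vectors m n (A : 'M[R]_(m, n)) : (n < m)%N ->
  exists2 l : 'rV[R]_m, l *m A = 0 & exists i, l 0 i < 0.
Proof.
move=> lt_nm.
have /rowV0Pn[l lA l0] : kermx A != 0.
  rewrite -mxrank_eq0 mxrank_ker subn_eq0 -ltnNge.
  exact: leq_ltn_trans (rank_leq_col A) lt_nm.
have lA0 : l *m A = 0 by apply/sub_kermxP.
have [i li0] : exists i, l 0 i != 0.
  apply/existsP; apply: contraNT l0 => /existsPn h.
  by apply/eqP/rowP => i; rewrite mxE; have /negPn/eqP := h i.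
case: (ltgtP (l 0 i) 0) li0 => // li _; first by exists l => //; exists i.
exists (- l); first by rewrite mulNmx lA0 oppr0.
by exists i; rewrite mxE oppr_lt0.
Qed.

(** A shattered set of functionals has at most M elements.  Otherwise they have
    a linear dependency l, and some point x gives the i-th of them a nonnegative
    value exactly when l_i is nonnegative.  At x all terms of the combination are
    nonnegative, those with l_i < 0 are positive, and yet the sum vanishes. *)
Lemma card_patterns M (X : finType) (u : X -> nat -> R) W :
  (#|[set pattern M W (u x) | x : X]| <= (size W).+1 ^ M)%N.
Proof.
pose trace (p : (size W).-tuple bool) := [set i : 'I_(size W) | tnth p i].
have trace_inj : injective trace.
  move=> p q /setP eq_pq; apply/eq_from_tnth => i.
  by have := eq_pq i; rewrite !inE.
rewrite -(card_imset _ trace_inj); set F := [set trace _ | _ in _].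
apply: leq_trans (card_shattered F) _.
rewrite -[in X in (_ <= X)%N](card_ord (size W)).
apply: leq_trans (card_bounded_subsets _ _).
apply/subset_leq_card/subsetP => S; rewrite !inE => /shattersP shS.
rewrite leqNgt; apply/negP => ltMS.
pose w (i : 'I_(size W)) := tnth (in_tuple W) i.
have [l lA [i0 li0]] := dependent_vectors
  (\matrix_(i < #|S|, s < M) w (enum_val i) s) ltMS.
pose B := [set enum_val i | i : 'I_#|S| & 0 <= l 0 i].
have sB : B \subset S.
  by apply/subsetP => _ /imsetP[i _ ->]; apply: enum_valP.
have [E /imsetP[_ /imsetP[x _ ->] ->] EB] := shS _ sB.
have posE (i : 'I_#|S|) : pos M (u x) (w (enum_val i)) = (0 <= l 0 i).
  have /setP/(_ (enum_val i)) := EB.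
  rewrite !inE enum_valP andbT tnth_map => ->.
  apply/imsetP/idP => [[j]|li]; last by exists i; rewrite ?inE.
  by rewrite inE => lj /enum_val_inj ->.
have : \sum_(i < #|S|) l 0 i * dot M (u x) (w (enum_val i)) = 0.
  transitivity (\sum_(s < M) u x s * (l *m \matrix_(i < #|S|, s < M) w (enum_val i) s) 0 s).
    under eq_bigr do rewrite mulr_sumr.
    rewrite exchange_big; apply: eq_bigr => s _.
    rewrite mxE mulr_sumr; apply: eq_bigr => i _.
    by rewrite !mxE; ring.
  by rewrite lA big1 // => s _; rewrite mxE mulr0.
apply/eqP; rewrite gt_eqF //.
rewrite (bigD1 i0) //= ltr_pwDl //.
  rewrite nmulr_rgt0 // ltNge.
  by have := posE i0; rewrite /pos => ->; rewrite -ltNge.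
apply: sumr_ge0 => i _; have := posE i; rewrite /pos.
have [li|li] := leP 0 (l 0 i) => h; first by rewrite mulr_ge0.
by rewrite mulr_le0 ?(ltW li) // ltW // ltNge h.
Qed.
End Halfspaces.

(** * Amplifying a weak bipartite regularity lemma *)

Section Mixed.
Variable T : finType.
Implicit Types (S : {set T}) (e : rel T) (P : pred T).

(** For an equivalence e this is a union of classes, those on which P is not
    constant. *)
Definition mixed S e P : {set T} :=
  [set p in S | [exists q in S, e p q && (P p != P q)]].

Lemma mixedP S e P p :
  reflect (p \in S /\ exists q, [/\ q \in S, e p q & P p != P q])
          (p \in mixed S e P).
Proof.
rewrite inE; apply: (iffP andP) => -[pS].
  by case/exists_inP => q qS /andP[epq nP]; split => //; exists q.
by case=> q [qS epq nP]; split => //; apply/exists_inP; exists q; rewrite ?epq.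
Qed.

Lemma mixed_sub S e P : mixed S e P \subset S.
Proof. by apply/subsetP => p /mixedP[]. Qed.

End Mixed.

Section Bipartite.
Variable R : realFieldType.
Implicit Types (W Z : seq (nat -> R)).

Definition mixed_pairs M (X Y : finType) (u : X -> nat -> R) (v : Y -> nat -> R)
    (A : {set X}) (B : {set Y}) W Z : {set X * Y} :=
  mixed (setX A B)
    (fun p q => same_side M W (u p.1) (u q.1) && same_side M Z (v p.2) (v q.2))
    (fun p => pos M (u p.1) (v p.2)).

Lemma card_mixed_pairs M (X Y : finType) (u : X -> nat -> R) (v : Y -> nat -> R)
    (A : {set X}) (B : {set Y}) W Z :
  (#|mixed_pairs M u v A B W Z| + #|setX A B :\: mixed_pairs M u v A B W Z|
   = #|A| * #|B|)%N.
Proof.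
rewrite -cardsX -(cardsID (mixed_pairs M u v A B W Z) (setX A B)).
by rewrite (setIidPr (mixed_sub _ _ _)).
Qed.

(** N bounds the number of cuts and is also the exponent of the proportion of
    pairs that they settle. *)
Definition weakly_regular M N :=
  forall (X Y : finType) (u : X -> nat -> R) (v : Y -> nat -> R)
         (A : {set X}) (B : {set Y}),
  exists W Z, [/\ size W <= N, size Z <= N
    & #|A| * #|B| <= 2 ^ N * #|setX A B :\: mixed_pairs M u v A B W Z|]%N.

(** The error 1 / eps is measured in powers of two, which keeps the statement
    within nat. *)
Definition strongly_regular M e :=
  forall m (X Y : finType) (u : X -> nat -> R) (v : Y -> nat -> R)
         (A : {set X}) (B : {set Y}),
  exists W Z, [/\ size W <= 2 ^ (e * m.+1), size Z <= 2 ^ (e * m.+1)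
    & #|mixed_pairs M u v A B W Z| * 2 ^ m <= #|A| * #|B|]%N.

(** The bounded family of cuts comes first, and the induction hypothesis is
    applied inside each of the at most 4^N products of cells.  Each round then
    multiplies the number of cuts by a constant factor, whereas refining the
    partition reached after j rounds would multiply it by the number of its
    cells.  Settled products stay settled under refinement, and the others lose
    the same proportion of their pairs. *)
Lemma weak_iterated M N j : weakly_regular M N ->
  forall (X Y : finType) (u : X -> nat -> R) (v : Y -> nat -> R)
         (A : {set X}) (B : {set Y}),
  exists W Z, [/\ size W <= (N + 4 ^ N) ^ j, size Z <= (N + 4 ^ N) ^ j
    & (2 ^ N) ^ j * #|mixed_pairs M u v A B W Z|
      <= (2 ^ N).-1 ^ j * (#|A| * #|B|)]%N.
Proof.
move=> wkM X Y u v; elim: j => [|j IHj] A B.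
  exists [::], [::]; split => //; rewrite !expn0 !mul1n -cardsX.
  exact/subset_leq_card/mixed_sub.
have [W [Z [leW leZ cardAB]]] := wkM X Y u v A B.
pose pt (z : X * Y) := (pattern M W (u z.1), pattern M Z (v z.2)).
pose cA s := [set x in A | pattern M W (u x) == s].
pose cB s := [set y in B | pattern M Z (v y) == s].
have /fin_all_exists[WZ WZP] : forall p, exists WZ : seq (nat -> R) * seq (nat -> R),
    [/\ size WZ.1 <= (N + 4 ^ N) ^ j, size WZ.2 <= (N + 4 ^ N) ^ j
    & (2 ^ N) ^ j * #|mixed_pairs M u v (cA p.1) (cB p.2) WZ.1 WZ.2|
      <= (2 ^ N).-1 ^ j * (#|cA p.1| * #|cB p.2|)]%N.
  move=> p; have [W' [Z' [? ? ?]]] := IHj (cA p.1) (cB p.2).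
  by exists (W', Z').
pose P := enum {: (size W).-tuple bool * (size Z).-tuple bool}.
have leP : (size P <= 4 ^ N)%N.
  rewrite /P -cardE card_prod !card_tuple card_bool -expnD.
  by rewrite (_ : 4 = 2 ^ 2)%N // -expnM leq_exp2l //; lia.
have leflat (F : _ -> seq (nat -> R)) (V : seq (nat -> R)) : (size V <= N)%N ->
    (forall p, p \in P -> size (F p) <= (N + 4 ^ N) ^ j)%N ->
    (size (V ++ flatten [seq F p | p <- P]) <= (N + 4 ^ N) ^ j.+1)%N.
  move=> leV leF; rewrite size_cat expnS mulnDl leq_add //.
    by rewrite (leq_trans leV) // leq_pmulr // expn_gt0; case: (N).
  apply: leq_trans (size_flatten_le leF) _.
  by rewrite leq_mul2r leP orbT.
exists (W ++ flatten [seq (WZ p).1 | p <- P]).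
exists (Z ++ flatten [seq (WZ p).2 | p <- P]).
split; try by apply: leflat => // p _; case: (WZP p).
set W1 := W ++ _; set Z1 := Z ++ _.
set mix1 := mixed_pairs M u v A B W1 Z1; set mix := mixed_pairs M u v A B W Z in cardAB.
have le_mix : (2 ^ N * #|mix| <= (2 ^ N).-1 * (#|A| * #|B|))%N.
  have := card_mixed_pairs M u v A B W Z; rewrite -/mix.
  have : (0 < 2 ^ N)%N by rewrite expn_gt0.
  move: cardAB; rewrite -/mix; move: #|_ :\: _| #|mix| => c c'.
  case: (2 ^ N)%N => //= q + _ eqAB; rewrite -eqAB mulnDr !mulSn; lia.
suff step : ((2 ^ N) ^ j * #|mix1| <= (2 ^ N).-1 ^ j * #|mix|)%N.
  rewrite expnSr expnSr -!mulnA (mulnCA _ (2 ^ N)%N) .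
  apply: leq_trans (leq_mul (leqnn (2 ^ N)%N) step) _.
  by rewrite mulnCA leq_mul2l le_mix orbT.
rewrite (card_fibers mix1 pt) (card_fibers mix pt) !big_distrr /=.
apply: leq_sum => p _.
have [->|[z0]] := set_0Vmem [set z in mix1 | pt z == p]; first by rewrite cards0 muln0.
have same_pt z z' : pt z = pt z' -> same_side M W (u z.1) (u z'.1) && same_side M Z (v z.2) (v z'.2).
  by move=> /eqP; rewrite !same_side_pattern xpair_eqE.
rewrite inE => /andP[/mixedP[z0AB [z1 [z1AB z01 nP]]] /eqP z0p].
have z01W : same_side M W (u z0.1) (u z1.1) && same_side M Z (v z0.2) (v z1.2).
  by move: z01; rewrite !same_side_cat => /andP[/andP[-> _] /andP[-> _]].
have cell z : (z \in setX (cA p.1) (cB p.2)) = (z \in setX A B) && (pt z == p).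
  by case: p {z0p} => s t; rewrite !inE xpair_eqE /= andbACA.
have -> : [set z in mix | pt z == p] = setX (cA p.1) (cB p.2).
  apply/setP => z; rewrite inE cell; apply: andb_id2r => /eqP zp.
  apply/idP/idP => [/(subsetP (mixed_sub _ _ _)) //|zAB].
  apply/mixedP; split => //.
  have /same_pt zz0 : pt z = pt z0 by rewrite zp z0p.
  case: (eqVneq (pos M (u z.1) (v z.2)) (pos M (u z0.1) (v z0.2))) => [eq|neq].
    exists z1; rewrite eq; split => //.
    case/andP: zz0 => /same_side_trans t1 /same_side_trans t2.
    by case/andP: z01W => /t1-> /t2->.
  by exists z0.
have [_ _] := WZP p; rewrite -cardsX; apply: leq_trans.
rewrite leq_mul2l; apply/orP; right; apply/subset_leq_card/subsetP => z.
rewrite inE => /andP[/mixedP[zAB [z' [z'AB zz' nzz']]] /eqP zp].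
have pP : p \in P by rewrite mem_enum.
move: zz'; rewrite !same_side_cat => /andP[/andP[h1 h2] /andP[h3 h4]].
have z'p : pt z' = p.
  by rewrite -zp; apply/eqP; rewrite eq_sym xpair_eqE -!same_side_pattern h1.
apply/mixedP; split; first by rewrite cell zAB zp eqxx.
exists z'; split => //; first by rewrite cell z'AB z'p eqxx.
by rewrite (same_side_flatten pP h2) (same_side_flatten pP h4).
Qed.

(** That is, (1 - 1/C)^C <= 1/2, so C m rounds that each settle a proportion 1/C
    of the mixed pairs leave at most a proportion 2^-m of them. *)
Lemma half_power C : (0 < C)%N -> (2 * C.-1 ^ C <= C ^ C)%N.
Proof.
case: C => // c _ /=; have := expnDn c 1 c.+1; rewrite addn1 => ->.
rewrite big_ord_recl big_ord_recl /=.
rewrite subn0 !exp1n !muln1 bin0 mul1n bin1 /bump /= subSS subn0.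
apply: (@leq_trans (c ^ c.+1 + c.+1 * c ^ c)%N); last lia.
by rewrite mul2n -addnn leq_add2l expnS leq_mul2r leqnSn orbT.
Qed.

Lemma strong_of_weak M N : weakly_regular M N ->
  exists e, strongly_regular M e.
Proof.
move=> wkM; set G := (N + 4 ^ N)%N.
exists (G * 2 ^ N)%N => m X Y u v A B.
have [W [Z [leW leZ le_mix]]] := weak_iterated (2 ^ N * m) wkM u v A B.
have leG : (G ^ (2 ^ N * m) <= 2 ^ (G * 2 ^ N * m.+1))%N.
  apply: (@leq_trans ((2 ^ G) ^ (2 ^ N * m))).
    by rewrite leq_expn // ltnW // ltn_expl.
  by rewrite -expnM -mulnA leq_exp2l // leq_mul2l leq_mul2l leqnSn !orbT.
exists W, Z; split; [exact: leq_trans leG|exact: leq_trans leG|].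
set C := (2 ^ N)%N in le_mix *; have C_gt0 : (0 < C)%N by rewrite expn_gt0.
have halves : (2 ^ m * C.-1 ^ (C * m) <= C ^ (C * m))%N.
  by rewrite !expnM -expnMn leq_expn // half_power.
rewrite -(@leq_pmul2l (C ^ (C * m))) ?expn_gt0 ?C_gt0 // mulnA.
apply: leq_trans (leq_mul le_mix (leqnn (2 ^ m))) _.
by rewrite mulnAC leq_mul2r [(_.-1 ^ _ * _)%N]mulnC halves orbT.
Qed.
End Bipartite.

(** * Raising the dimension *)

Section Step.
Variable R : realFieldType.
Implicit Types (W Z : seq (nat -> R)).

Definition extend M (w : nat -> R) c : nat -> R := fun s => if (s < M)%N then w s else c.

Lemma dotS M (a b : nat -> R) : dot M.+1 a b = dot M a b + a M * b M.
Proof. by rewrite /dot big_ord_recr. Qed.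

Lemma dot_extend M (a w : nat -> R) c : dot M.+1 a (extend M w c) = dot M a w + a M * c.
Proof.
rewrite dotS /extend ltnn; congr (_ + _).
by apply: eq_dot => s ->.
Qed.

Lemma same_side_map M M' (h : (nat -> R) -> (nat -> R)) W (a b a' b' : nat -> R) :
  (forall w, dot M' a' (h w) = dot M a w) -> (forall w, dot M' b' (h w) = dot M b w) ->
  same_side M' [seq h w | w <- W] a' b' = same_side M W a b.
Proof.
by move=> ha hb; rewrite /same_side -!map_comp; congr (_ == _); apply: eq_map => w /=;
  rewrite /pos ?ha ?hb.
Qed.

(** Here [sg] is the common sign of the last coordinates of the functionals
    v y for y in B, and [a y] is the absolute value of that coordinate.  The
    sign of v y at u x is decided by comparing the last coordinate of u x, times
    - sg, with [g x y]; two such thresholds compare according to the sign at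
    u x of the functional [D], which ignores that coordinate. *)
Section Pivot.
Variables (M : nat) (X Y : finType) (u : X -> nat -> R) (v : Y -> nat -> R).
Variable sg : R.
Hypothesis sg2 : sg * sg = 1.

Let a y := sg * v y M.
Let g x y := dot M (u x) (v y) / a y.
Let D (p : Y * Y) s := v p.1 s * a p.2 - v p.2 s * a p.1.

Lemma dotD x p :
  dot M (u x) (D p) = dot M (u x) (v p.1) * a p.2 - dot M (u x) (v p.2) * a p.1.
Proof. by rewrite /dot !mulr_suml -sumrB; apply: eq_bigr => s _; rewrite /D; ring. Qed.

Lemma pos_compare x y1 y2 : 0 < a y1 -> 0 < a y2 ->
  pos M (u x) (D (y1, y2)) = (g x y2 <= g x y1).
Proof.
by move=> a1 a2; rewrite /pos dotD /g subr_ge0 ler_pdivrMr // mulrAC ler_pdivlMr.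
Qed.

Lemma pos_threshold x y : 0 < a y -> pos M.+1 (u x) (v y) = (- (sg * u x M) <= g x y).
Proof.
move=> ay; rewrite /pos dotS /g ler_pdivlMr // -[in RHS]subr_ge0 mulNr opprK.
by congr (0 <= _ + _); rewrite /a mulrACA sg2 mul1r.
Qed.

(** The pairs (y, y0) with y0 fixed depend linearly on y, so a cut z of the space
    of pairs pulls back to a cut of the space of single functionals. *)
Definition fix_right y0 (z : nat -> R) :=
  extend M (fun s => a y0 * z s) (- (sg * dot M (v y0) z)).
Definition fix_left y0 (z : nat -> R) :=
  extend M (fun s => - (a y0 * z s)) (sg * dot M (v y0) z).

Lemma dot_fix_right y y0 z : dot M.+1 (v y) (fix_right y0 z) = dot M (D (y, y0)) z.
Proof.
rewrite dot_extend /D /dot /= mulrN mulrA -/(a y) mulr_sumr -sumrB.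
by apply: eq_bigr => s _; rewrite /a; ring.
Qed.

Lemma dot_fix_left y y0 z : dot M.+1 (v y) (fix_left y0 z) = dot M (D (y0, y)) z.
Proof.
rewrite dot_extend /D /dot /= mulrA -/(a y) mulr_sumr -big_split /=.
by apply: eq_bigr => s _; rewrite /a; ring.
Qed.

Variables (e : nat) (A : {set X}) (B : {set Y}).
Hypothesis strM : strongly_regular R M e.
Hypothesis aB : {in B, forall y, 0 < a y}.

(** The regularity of the comparisons is used with error 2^-8.  Let n be the size of
    B: a quarter of the points of A at most lies in n^2 / 64 or more mixed triples, and for any
    other point x0 at most n / 8 functionals lie in n / 8 or more mixed pairs on
    either side.  Together with the two quarters of extreme ranks this
    excludes fewer than n candidates for y0, and n / 4 - n / 8 functionals
    remain above y0, and as many below it. *)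
Lemma pivot : exists W Z, [/\ size W <= (2 ^ (e * 9)).+1, size Z <= 2 * 2 ^ (e * 9)
    & #|A| * #|B| <= 2 ^ (2 ^ (e * 9) + 5) *
                    #|setX A B :\: mixed_pairs M.+1 u v A B W Z|]%N.
Proof.
have [->|A0] := eqVneq A set0; first by exists [::], [::]; rewrite cards0.
have [->|B0] := eqVneq B set0; first by exists [::], [::]; rewrite cards0 muln0.
have [W [Z [leW leZ]]] := strM 8 u D A (setX B B).
set N := (2 ^ (e * 9))%N in leW leZ *; set P := mixed_pairs _ _ _ _ _ _ _.
rewrite cardsX; set n := #|B| => leP.
have n_gt0 : (0 < n)%N by rewrite card_gt0.
have A_gt0 : (0 < #|A|)%N by rewrite card_gt0.
(* x0 must also have a large cell, so it is chosen by pigeonhole among the points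
   of few mixed triples *)
pose fib x := [set z in P | z.1 == x].
pose A1 := A :\: [set x | n * n <= 64 * #|fib x|]%N.
have cardA1 : (#|A| <= 2 * #|A1|)%N.
  have bad := markov P (fun z => z.1) (n * n) 64; rewrite -/fib in bad.
  have : (#|[set x | n * n <= 64 * #|fib x| ]| * 4 <= #|A|)%N.
    rewrite -(leq_pmul2r (m := n * n)) ?muln_gt0 ?n_gt0 // mulnAC.
    apply: leq_trans (leq_mul bad (leqnn 4)) _.
    by apply: leq_trans leP; lia.
  have := cardsD A [set x | n * n <= 64 * #|fib x| ]%N; rewrite -/A1.
  have := subset_leq_card (subsetIr A [set x | n * n <= 64 * #|fib x| ]%N).
  by lia.
have [x0 x0A1 cardA2] : exists2 x0, x0 \in A1 &
    (#|A1| <= 2 ^ N * #|[set x in A1 | pattern M W (u x) == pattern M W (u x0)]|)%N.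
  have [|x0 x0A1 le0] := @pigeonhole _ _ A1 (fun x => pattern M W (u x)).
    by move: A_gt0 cardA1; lia.
  exists x0 => //; apply: leq_trans le0 _; rewrite leq_mul2r card_tuple card_bool.
  by rewrite leq_exp2l // leW orbT.
set A2 := [set x in A1 | _] in cardA2.
pose P0 := [set z.2 | z in fib x0].
have cardP0 : (64 * #|P0| < n * n)%N.
  move: x0A1; rewrite !inE -ltnNge => /andP[lt0 _].
  by apply: leq_ltn_trans lt0; rewrite leq_mul2l /= leq_imset_card.
have x0A : x0 \in A by move: x0A1; rewrite inE => /andP[].
(* of the four bad sets, the first two hold the extreme ranks at x0, the others
   the functionals of many mixed pairs *)
pose lowset y := [set y1 in B | g x0 y1 <= g x0 y].
pose highset y := [set y1 in B | g x0 y <= g x0 y1].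
pose low := [set y in B | 4 * #|lowset y| < n]%N.
pose high := [set y in B | 4 * #|highset y| < n]%N.
pose bad1 := [set y | n <= 8 * #|[set p in P0 | p.1 == y]|]%N.
pose bad2 := [set y | n <= 8 * #|[set p in P0 | p.2 == y]|]%N.
have le_low : (4 * #|low| <= n)%N by apply: few_low_ranks.
have le_high : (4 * #|high| <= n)%N.
  have := few_low_ranks (fun y => - g x0 y) B.
  suff -> : high = [set y in B |
      4 * #|[set y1 in B | (- g x0 y1 <= - g x0 y)%R]| < #|B| ]%N by [].
  apply/setP => y; rewrite !inE; congr (_ && (_ * _ < _)%N).
  by apply: eq_card => y1; rewrite !inE lerN2.
have le_bad (f : Y * Y -> Y) :
    (8 * #|[set y | n <= 8 * #|[set p in P0 | f p == y]| ]%N| < n)%N.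
  rewrite -(ltn_pmul2r (m := n)) //; apply: leq_ltn_trans cardP0.
  have := markov P0 f n 8; lia.
have le_bad1 := le_bad fst; have le_bad2 := le_bad snd.
rewrite -/bad1 in le_bad1; rewrite -/bad2 in le_bad2.
have [y0] : exists y0, y0 \in B :\: (low :|: high :|: bad1 :|: bad2).
  apply/set0Pn; rewrite -card_gt0 cardsD subn_gt0.
  apply: leq_ltn_trans (subset_leq_card (subsetIr _ _)) _.
  apply: leq_ltn_trans (leq_card_setU _ _) _.
  have [le1 _] := leq_card_setU (low :|: high) bad1.
  have [le2 _] := leq_card_setU low high.
  by rewrite -/n; lia.
rewrite inE 3!in_setU !negb_or -!andbA => /and5P[y0low y0high y0b1 y0b2 y0B].
have {y0low} y0low : (n <= 4 * #|lowset y0|)%N.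
  by move: y0low; rewrite inE y0B /= -leqNgt.
have {y0high} y0high : (n <= 4 * #|highset y0|)%N.
  by move: y0high; rewrite inE y0B /= -leqNgt.
have {y0b1} y0b1 : (8 * #|[set p in P0 | p.1 == y0]| < n)%N.
  by move: y0b1; rewrite inE -ltnNge.
have {y0b2} y0b2 : (8 * #|[set p in P0 | p.2 == y0]| < n)%N.
  by move: y0b2; rewrite inE -ltnNge.
pose lo := [set y in lowset y0 | (y0, y) \notin P0].
pose hi := [set y in highset y0 | (y, y0) \notin P0].
have card_lo : (n <= 8 * #|lo|)%N.
  have := cardsID [set y | (y0, y) \in P0] (lowset y0).
  have -> : lowset y0 :\: [set y | (y0, y) \in P0] = lo.
    by apply/setP => y; rewrite !inE andbC.
  suff : (#|lowset y0 :&: [set y | (y0, y) \in P0]| <= #|[set p in P0 | p.1 == y0]|)%N.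
    by move: y0low y0b1; lia.
  have inj : injective (fun y : Y => (y0, y)) by move=> ? ? [].
  rewrite -(card_imset _ inj).
  apply/subset_leq_card/subsetP => _ /imsetP[y yI ->].
  have /setIP[_] := yI; rewrite inE => yP.
  by rewrite inE yP /=.
have card_hi : (n <= 8 * #|hi|)%N.
  have := cardsID [set y | (y, y0) \in P0] (highset y0).
  have -> : highset y0 :\: [set y | (y, y0) \in P0] = hi.
    by apply/setP => y; rewrite !inE andbC.
  suff : (#|highset y0 :&: [set y | (y, y0) \in P0]| <= #|[set p in P0 | p.2 == y0]|)%N.
    by lia.
  have inj : injective (fun y : Y => (y, y0)) by move=> ? ? [].
  rewrite -(card_imset _ inj).
  apply/subset_leq_card/subsetP => _ /imsetP[y yI ->].
  have /setIP[_] := yI; rewrite inE => yP.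
  by rewrite inE yP /=.
pose W' := v y0 :: [seq extend M w 0 | w <- W].
pose Z' := [seq fix_right y0 z | z <- Z] ++ [seq fix_left y0 z | z <- Z].
exists W', Z'; split; first by rewrite /= size_map ltnS.
  by rewrite size_cat !size_map mul2n -addnn leq_add.
set good := _ :\: _.
have A2A x : x \in A2 -> x \in A.
  by rewrite !inE -!andbA => /and3P[].
(* off P0, a comparison at x0 persists on the whole product of cells, also from
   other points of the cell of x0, as the new cuts refine W and pull back Z *)
have unmixed x y1 y2 x' y1' y2' : (y1, y2) \notin P0 -> x \in A2 -> x' \in A ->
    y1 \in B -> y2 \in B -> y1' \in B -> y2' \in B ->
    same_side M.+1 W' (u x) (u x') -> same_side M Z (D (y1, y2)) (D (y1', y2')) ->
    pos M (u x') (D (y1', y2')) = pos M (u x0) (D (y1, y2)).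
  move=> nP xA2 x'A B1 B2 B1' B2'; rewrite same_side_cons => /andP[_ xx'] yy'.
  apply/eqP; apply: contraNT nP => neq.
  apply/imsetP; exists (x0, (y1, y2)) => //; rewrite inE eqxx andbT.
  apply/mixedP; split; first by rewrite !inE x0A B1 B2.
  exists (x', (y1', y2')); split; rewrite /= ?inE /= ?x'A ?B1' ?B2' 1?eq_sym //.
  rewrite yy' andbT.
  apply: (@same_side_trans _ _ _ _ (u x)).
    by move: xA2; rewrite same_side_sym inE same_side_pattern => /andP[].
  by move: xx'; rewrite (@same_side_map M _ _ _ (u x) (u x')) // => w;
    rewrite dot_extend mulr0 addr0.
have hi_good x y : x \in A2 -> y \in hi -> pos M.+1 (u x) (v y0) -> (x, y) \in good.
  move=> xA2 y_hi px.
  have /andP[/andP[yB le_y] nP] : (y \in B) && (g x0 y0 <= g x0 y) && ((y, y0) \notin P0).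
    by move: y_hi; rewrite !inE.
  rewrite in_setD in_setX /= A2A // yB !andbT; apply/negP => /mixedP[_ [[x' y'] [/=]]].
  rewrite in_setX /= => /andP[x'A y'B] /andP[sW sZ] /eqP; apply.
  have up x1 y1 : x1 \in A -> y1 \in B -> same_side M.+1 W' (u x) (u x1) ->
      same_side M.+1 Z' (v y) (v y1) -> pos M.+1 (u x1) (v y1).
    move=> x1A y1B sW1; rewrite same_side_cat => /andP[+ _].
    rewrite (@same_side_map M _ _ _ (D (y, y0)) (D (y1, y0))); try exact: dot_fix_right.
    move=> sZ1; have := unmixed _ _ _ _ _ _ nP xA2 x1A yB y0B y1B y0B sW1 sZ1.
    rewrite !pos_compare ?aB // le_y => le1.
    move: sW1; rewrite same_side_cons px => /andP[/eqP/esym px1 _].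
    rewrite pos_threshold ?aB //; apply: le_trans le1.
    by rewrite -pos_threshold ?aB.
  rewrite /= (up x y) ?A2A ?same_side_refl //; exact/esym/up.
have lo_good x y : x \in A2 -> y \in lo -> ~~ pos M.+1 (u x) (v y0) -> (x, y) \in good.
  move=> xA2 y_lo px.
  have /andP[/andP[yB le_y] nP] : (y \in B) && (g x0 y <= g x0 y0) && ((y0, y) \notin P0).
    by move: y_lo; rewrite !inE.
  rewrite in_setD in_setX /= A2A // yB !andbT; apply/negP => /mixedP[_ [[x' y'] [/=]]].
  rewrite in_setX /= => /andP[x'A y'B] /andP[sW sZ] /eqP; apply.
  have down x1 y1 : x1 \in A -> y1 \in B -> same_side M.+1 W' (u x) (u x1) ->
      same_side M.+1 Z' (v y) (v y1) -> pos M.+1 (u x1) (v y1) = false.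
    move=> x1A y1B sW1; rewrite same_side_cat => /andP[_ +].
    rewrite (@same_side_map M _ _ _ (D (y0, y)) (D (y0, y1))); try exact: dot_fix_left.
    move=> sZ1; have := unmixed _ _ _ _ _ _ nP xA2 x1A y0B yB y0B y1B sW1 sZ1.
    rewrite !pos_compare ?aB // le_y => le1.
    move: sW1; rewrite same_side_cons (negPf px) => /andP[/eqP/esym/negbT px1 _].
    apply: contraNF px1; rewrite !pos_threshold ?aB // => /le_trans; exact.
  rewrite /= (down x y) ?A2A ?same_side_refl //; exact/esym/down.
pose A2p := [set x in A2 | pos M.+1 (u x) (v y0)].
pose A2n := [set x in A2 | ~~ pos M.+1 (u x) (v y0)].
have cardA2pn : (#|A2| = #|A2p| + #|A2n|)%N.
  rewrite -(cardsID [set x | pos M.+1 (u x) (v y0)] A2); congr (_ + _)%N;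
    by apply: eq_card => x; rewrite !inE // andbC.
have card_good : (#|A2p| * #|hi| + #|A2n| * #|lo| <= #|good|)%N.
  rewrite -!cardsX; have [_ eqU] := leq_card_setU (setX A2p hi) (setX A2n lo).
  have dis : [disjoint setX A2p hi & setX A2n lo].
    rewrite disjoint_subset; apply/subsetP => -[x y]; rewrite in_setX => /andP[xp _].
    rewrite inE in_setX; apply/negP => /andP[xn _]; move: xp xn; rewrite !in_set /=.
    by case/andP => _ ->; rewrite andbF.
  rewrite dis in eqU; rewrite -(eqP eqU).
  apply/subset_leq_card/subsetP => -[x y] /setUP[] /setXP[/= + yh];
    rewrite in_set => /andP[xA2 px]; [exact: hi_good|exact: lo_good].
have n_good : (#|A2| * n <= 8 * #|good|)%N.
  apply: (@leq_trans (8 * (#|A2p| * #|hi| + #|A2n| * #|lo|))); last by rewrite leq_mul2l.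
  rewrite cardA2pn mulnDl mulnDr.
  by rewrite ![(8 * (_ * _))%N]mulnCA leq_add // leq_mul2l ?card_hi ?card_lo orbT.
rewrite -/n expnD.
apply: (@leq_trans (2 * (2 ^ N * #|A2|) * n)).
  by rewrite leq_mul2r (leq_trans cardA1) ?orbT // leq_mul2l.
rewrite -!mulnA mulnCA leq_mul2l; apply/orP; right.
by move: n_good; lia.
Qed.
End Pivot.

(** Without a last coordinate the functionals live in dimension M. *)
Lemma degenerate_pivot M e (X Y : finType) (u : X -> nat -> R) (v : Y -> nat -> R)
    (A : {set X}) (B : {set Y}) :
  strongly_regular R M e -> {in B, forall y, v y M = 0} ->
  exists W Z, [/\ size W <= 2 ^ (e * 2), size Z <= 2 ^ (e * 2)
    & #|A| * #|B| <= 2 * #|setX A B :\: mixed_pairs M.+1 u v A B W Z|]%N.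
Proof.
move=> strM v0; have [W [Z [leW leZ leP]]] := strM 1%N X Y u v A B.
exists [seq extend M w 0 | w <- W], [seq extend M z 0 | z <- Z].
rewrite !size_map; split => //; set mix' := mixed_pairs _ _ _ _ _ _ _.
have sub : mix' \subset mixed_pairs M u v A B W Z.
  apply/subsetP => -[x y] /mixedP[xyAB [[x' y'] [x'y'AB /andP[sW sZ]]]].
  rewrite /pos !dotS.
  have [yB y'B] : y \in B /\ y' \in B.
    by move: xyAB x'y'AB; rewrite !in_setX => /andP[_ ->] /andP[_ ->].
  rewrite !v0 // !mulr0 !addr0 => neq; apply/mixedP; split => //.
  exists (x', y'); split => //=; apply/andP; split.
    by move: sW; rewrite (@same_side_map M _ _ _ (u x) (u x')) // => w;
      rewrite dot_extend mulr0 addr0.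
  by move: sZ; rewrite (@same_side_map M _ _ _ (v y) (v y')) // => w;
    rewrite dot_extend mulr0 addr0.
have := card_mixed_pairs M.+1 u v A B [seq extend M w 0 | w <- W] [seq extend M z 0 | z <- Z].
rewrite -/mix'; rewrite expn1 in leP; have := subset_leq_card sub; lia.
Qed.

(** Cuts Z' that separate B' from the rest of B make the pairs settled within B'
    count as settled within B. *)
Lemma mixed_pairs_refine M (X Y : finType) (u : X -> nat -> R) (v : Y -> nat -> R)
    (A : {set X}) (B B' : {set Y}) W Z Z' :
  B' \subset B ->
  {in B' & B, forall y y', same_side M Z' (v y) (v y') -> y' \in B'} ->
  setX A B' :\: mixed_pairs M u v A B' W Z
    \subset setX A B :\: mixed_pairs M u v A B W (Z' ++ Z).
Proof.
move=> sB closedB'; apply/subsetP => -[x y].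
rewrite !in_setD !in_setX /= => /andP[nP /andP[xA yB']].
rewrite xA (subsetP sB) // !andbT; apply: contra nP => /mixedP[_ [[x' y'] [/= + + neq]]].
rewrite in_setX same_side_cat /= => /andP[x'A y'B] /and3P[sW sZ' sZ].
apply/mixedP; split; first by rewrite in_setX xA.
exists (x', y'); rewrite /= sW sZ in_setX /= x'A; split => //.
exact: closedB' yB' y'B sZ'.
Qed.

(** Half-spaces on the last coordinate split B into functionals of constant
    sign there; only the most numerous class is treated. *)
Lemma weak_step M e : strongly_regular R M e ->
  exists N, weakly_regular R M.+1 N.
Proof.
move=> strM; pose N := (2 ^ (e * 9))%N; exists (2 * N + 7)%N => X Y u v A B.
have N_gt0 : (0 < N)%N by rewrite expn_gt0.
have [->|B0] := eqVneq B set0; first by exists [::], [::]; rewrite cards0 muln0.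
pose f y := (0 < v y M, v y M < 0).
have [y0 y0B leB] : exists2 y0, y0 \in B & (#|B| <= 4 * #|[set y in B | f y == f y0]|)%N.
  have [|y0 y0B] := @pigeonhole _ _ B f; first by rewrite card_gt0.
  by rewrite card_prod card_bool; exists y0.
set B' := [set y in B | _] in leB.
have sB : B' \subset B by apply/subsetP => y; rewrite inE => /andP[].
suff [W [Z [leW leZ leG]]] : exists W Z, [/\ size W <= N.+1, size Z <= 2 * N
    & #|A| * #|B'| <= 2 ^ (N + 5) *
                    #|setX A B' :\: mixed_pairs M.+1 u v A B' W Z|]%N.
  pose Z1 := [:: extend M (fun=> 0) 1; extend M (fun=> 0) (-1)].
  exists W, (Z1 ++ Z); split.
  - by apply: leq_trans leW _; lia.
  - by rewrite size_cat /=; lia.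
  have le1 : (#|A| * #|B| <= 4 * (#|A| * #|B'|))%N by rewrite mulnCA leq_mul2l leB orbT.
  apply: leq_trans le1 _; apply: leq_trans (leq_mul (leqnn 4) leG) _.
  rewrite mulnA leq_mul //.
    by rewrite (_ : 4 = 2 ^ 2)%N // -expnD leq_exp2l //; lia.
  apply/subset_leq_card/mixed_pairs_refine => // y y'; rewrite !in_set.
  case/andP => _ /eqP fy y'B.
  rewrite !same_side_cons /pos !dot_extend /= !mulr1 !mulrN1.
  have d0 (b : nat -> R) : dot M b (fun=> 0) = 0.
    by rewrite /dot big1 // => s _; rewrite mulr0.
  rewrite !d0 !add0r !oppr_ge0 => /and3P[/eqP h1 /eqP h2 _].
  by rewrite y'B -fy /f xpair_eqE !ltNge h1 h2 !eqxx.
have [p0|p0] := boolP (0 < v y0 M).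
- apply: (@pivot M X Y u v 1 _ e) => //; first by rewrite mulr1.
  move=> y; rewrite inE mul1r => /andP[_ /eqP[-> _]] //.
have [n0|n0] := boolP (v y0 M < 0).
- apply: (@pivot M X Y u v (-1) _ e) => //; first by rewrite mulrNN mulr1.
  move=> y; rewrite inE mulN1r oppr_gt0 => /andP[_ /eqP[_ ->]] //.
have [|W [Z [leW leZ leG]]] := @degenerate_pivot M e X Y u v A B' strM.
  move=> y; rewrite inE => /andP[_ /eqP[]].
  rewrite (negPf p0) (negPf n0) => /negbT h1 /negbT h2.
  by apply/eqP; rewrite eq_le !leNgt h1 h2.
have leN : (2 ^ (e * 2) <= N)%N by rewrite leq_exp2l // leq_mul2l orbT.
exists W, Z; split; [lia|lia|].
apply: leq_trans leG _; rewrite leq_mul2r -[X in (X <= _)%N]expn1 leq_exp2l ?orbT //; lia.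
Qed.
End Step.

(** * Forms in several points *)

(** The induction on M starts in dimension 0, where all inner products vanish;
    each step amplifies the lower dimension before raising it. *)
Lemma bipartite_regularity (R : realFieldType) M : exists e, strongly_regular R M e.
Proof.
elim: M => [|M [e /weak_step[N /strong_of_weak]]] //.
apply: (@strong_of_weak _ _ 0%N) => X Y u v A B; exists [::], [::]; split => //.
rewrite mul1n -(card_mixed_pairs 0 u v A B [::] [::]).
rewrite [X in (X + _)%N](_ : _ = 0%N) ?add0n //; apply/eqP; rewrite cards_eq0.
apply/eqP/setP => z; rewrite in_set0; apply/negP => /mixedP[_ [q [_ _]]].
by rewrite /pos /dot !big_ord0 eqxx.
Qed.

Section Slots.
Variables (k : nat) (X : finType).

Definition update (x : {ffun 'I_k -> X}) l a : {ffun 'I_k -> X} :=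
  [ffun l' => if l' == l then a else x l'].

End Slots.

Section Multipartite.
Variable R : realFieldType.
Implicit Types (W Z : seq (nat -> R)).

(** A form on k points is known only through its values on X: in each slot it is
    a combination of the M coordinates of u. *)
Definition slotwise M k (X : finType) (u : X -> nat -> R) (f : {ffun 'I_k -> X} -> R) :=
  forall l x, exists c, forall a, f (update x l a) = dot M (u a) c.

Definition same_cells M k (X : finType) (u : X -> nat -> R) W :
    rel {ffun 'I_k -> X} :=
  fun x y => [forall l, same_side M W (u (x l)) (u (y l))].

Definition mixed_tuples M k (X : finType) (u : X -> nat -> R) W
    (f : {ffun 'I_k -> X} -> R) : {set {ffun 'I_k -> X}} :=
  mixed setT (same_cells M u W) (fun x => 0 <= f x).

Lemma slotwise_sum M k (X I : finType) (u : X -> nat -> R)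
    (f : I -> {ffun 'I_k -> X} -> R) (p : I -> R) :
  (forall i, slotwise M u (f i)) -> slotwise M u (fun x => \sum_i p i * f i x).
Proof.
move=> sf l x; have /fin_all_exists[c cP] := fun i => sf i l x.
exists (fun s => \sum_i p i * c i s) => a.
rewrite /dot; under [RHS]eq_bigr do rewrite mulr_sumr.
rewrite exchange_big; apply: eq_bigr => i _; rewrite cP /dot mulr_sumr.
by apply: eq_bigr => s _; ring.
Qed.

(** The coefficients of h over the coordinates of u can be chosen linear in h:
    if U is the matrix of u and U Q U = U, then h = U c implies h = U (Q h).
    Hence, when h is a slice of a form, its coefficients are combinations of
    slices, and so are forms in the remaining points. *)
Lemma interpolation M (X : finType) (u : X -> nat -> R) :
  exists p : nat -> X -> R, forall h : X -> R,
    (exists c, forall a, h a = dot M (u a) c) ->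
    forall a, h a = dot M (u a) (fun s => \sum_b p s b * h b).
Proof.
pose U := \matrix_(i < #|X|, s < M) u (enum_val i) s.
have [Q UQU] : exists Q, U *m Q *m U = U.
  by exists (pinvmx U); apply/mulmxKpV/submx_refl.
pose p s (b : X) := if insub s is Some s' then Q s' (enum_rank b) else 0.
exists p => h [c hc] a.
pose H := \col_i h (enum_val i) : 'cV[R]_#|X|.
have HE : H = U *m \col_s c s.
  by apply/colP => i; rewrite !mxE hc; apply: eq_bigr => s _; rewrite !mxE.
have := congr1 (fun V => V *m \col_(s < M) c s) UQU.
rewrite -!mulmxA -HE => /colP/(_ (enum_rank a)).
rewrite [RHS]mxE enum_rankK => <-; rewrite mxE; apply: eq_bigr => s _.
rewrite !mxE enum_rankK; congr (_ * _).
rewrite [LHS](reindex (@enum_rank X)) /=; last exact/onW_bij/enum_rank_bij.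
by apply: eq_bigr => b _; rewrite /p valK mxE enum_rankK.
Qed.

Section Cons.
Variables (k : nat) (X : finType).

Definition fcons a (y : {ffun 'I_k -> X}) : {ffun 'I_k.+1 -> X} :=
  [ffun l => if unlift ord0 l is Some l' then y l' else a].

Definition ftail (x : {ffun 'I_k.+1 -> X}) : {ffun 'I_k -> X} :=
  [ffun l => x (lift ord0 l)].

Lemma fconsK (x : {ffun 'I_k.+1 -> X}) : fcons (x ord0) (ftail x) = x.
Proof. by apply/ffunP => l; rewrite !ffunE; case: unliftP => [j|] ->; rewrite ?ffunE. Qed.

Lemma update_fcons0 a b y : update (fcons b y) ord0 a = fcons a y.
Proof.
apply/ffunP => l; rewrite !ffunE; case: unliftP => [j|] ->; rewrite ?eqxx //.
Qed.

Lemma update_fcons_lift a b y l :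
  update (fcons b y) (lift ord0 l) a = fcons b (update y l a).
Proof.
apply/ffunP => l'; rewrite !ffunE; case: unliftP => [j|] ->.
  by rewrite (inj_eq lift_inj) ffunE.
by rewrite (negPf (neq_lift _ _)).
Qed.

End Cons.

(** Step from k to k + 1: let E := e1 (m + 2), so that the bipartite lemma at scale m + 1 cuts the
    tuples of the last k points by at most 2^E forms.  The induction hypothesis
    is applied to each of them at scale m + 1 + E, so that all of them together
    spoil a proportion 2^-(m+1) of the tuples; outside these, equal cells in each
    slot imply equal signs for the 2^E forms. *)
Lemma multipartite_regularity M k : exists e,
  forall m (X : finType) (u : X -> nat -> R) (f : {ffun 'I_k -> X} -> R),
  slotwise M u f ->
  exists W, (size W <= 2 ^ (e * m.+1))%N /\
    (#|mixed_tuples M u W f| * 2 ^ m <= #|X| ^ k)%N.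
Proof.
have [e1 bip] := bipartite_regularity R M.
elim: k => [|k [e2 IHk]].
  exists 0%N => m X u f _; exists [::]; split => //.
  rewrite (_ : mixed_tuples _ _ _ _ = set0) ?cards0 //.
  apply/setP => x; rewrite in_set0; apply/negP => /mixedP[_ [y [_ _ /eqP]]].
  suff -> : x = y by [].
  by apply/ffunP; case.
exists (2 * (e1 + e2 * e1.+1) + 1)%N => m X u f sf.
have [p pP] := interpolation M u.
pose g y s := \sum_b p s b * f (fcons b y).
have fE a y : f (fcons a y) = dot M (u a) (g y).
  apply: (pP (fun b => f (fcons b y))).
  have [c cP] := sf ord0 (fcons a y); exists c => b.
  by rewrite -cP update_fcons0.
have [W [Z [leW leZ leP]]] := bip m.+1 X {ffun 'I_k -> X} u g setT setT.
set E := (e1 * m.+2)%N in leW leZ.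
pose fz (i : 'I_(size Z)) y := dot M (g y) (tnth (in_tuple Z) i).
have slot_fz i : slotwise M u (fz i).
  have fzE y : fz i y = \sum_b (\sum_(s < M) p s b * tnth (in_tuple Z) i s) * f (fcons b y).
    rewrite /fz /dot; under eq_bigr do rewrite mulr_suml.
    rewrite exchange_big; apply: eq_bigr => b _; rewrite mulr_suml.
    by apply: eq_bigr => s _; ring.
  have /slotwise_sum sl : forall b, slotwise M u (fun y => f (fcons b y)).
    move=> b l y; have [c cP] := sf (lift ord0 l) (fcons b y); exists c => a.
    by rewrite -cP update_fcons_lift.
  move=> l x; have [c cP] := sl (fun b => \sum_(s < M) p s b * tnth (in_tuple Z) i s) l x.
  by exists c => a; rewrite fzE cP.
have /fin_all_exists[V VP] := fun i => IHk (m.+1 + E)%N X u (fz i) (slot_fz i).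
exists (W ++ flatten [seq V i | i <- enum 'I_(size Z)]); split.
  rewrite size_cat; apply: (@leq_trans (2 ^ E + 2 ^ E * 2 ^ (e2 * (m.+1 + E).+1))).
    rewrite leq_add //; apply: leq_trans (size_flatten_le (m := 2 ^ (e2 * (m.+1 + E).+1)) _) _.
      by move=> i _; case: (VP i).
    by rewrite size_enum_ord leq_mul2r leZ orbT.
  rewrite -expnD; apply: (@leq_trans (2 ^ (E + e2 * (m.+1 + E).+1).+1)).
    by rewrite expnS mul2n -addnn leq_add2r leq_exp2l // leq_addr.
  by rewrite leq_exp2l // /E; nia.
set W' := W ++ _; pose split_tuple (x : {ffun 'I_k.+1 -> X}) := (x ord0, ftail x).
have inj_split : injective split_tuple.
  by move=> x x' [x0 xt]; rewrite -(fconsK x) x0 xt fconsK.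
pose S i := setX [set: X] (mixed_tuples M u (V i) (fz i)).
pose P := mixed_pairs M u g setT setT W Z.
have sub : [set split_tuple x | x in mixed_tuples M u W' f] \subset P :|: \bigcup_i S i.
  apply/subsetP => _ /imsetP[x xmix ->].
  apply: contraT; rewrite in_setU negb_or => /andP[nP nS].
  case/mixedP: xmix => _ [x' [_ /forallP xx' /negP[]]].
  have sW l : same_side M W (u (x l)) (u (x' l)).
    by have := xx' l; rewrite same_side_cat => /andP[].
  have sV i l : same_side M (V i) (u (x l)) (u (x' l)).
    have := xx' l; rewrite same_side_cat => /andP[_]; apply: same_side_flatten.
    by rewrite mem_enum.
  have sZ : same_side M Z (g (ftail x)) (g (ftail x')).
    rewrite same_side_pattern; apply/eqP/eq_from_tnth => i; rewrite !tnth_map.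
    apply/eqP; apply: contraNT nS => neq; apply/bigcupP; exists i => //.
    rewrite in_setX in_setT /=; apply/mixedP; split; rewrite ?in_setT //.
    exists (ftail x'); split; rewrite ?in_setT //.
    by apply/forallP => l; rewrite !ffunE.
  rewrite -(fconsK x) -(fconsK x') !fE; apply: contraNT nP => neq.
  apply/mixedP; split; first by rewrite !inE.
  by exists (split_tuple x'); rewrite /= sW sZ; split; rewrite ?inE.
have leS : ((\sum_i #|S i|) * 2 ^ m.+1 <= #|X| ^ k.+1)%N.
  rewrite -(leq_pmul2r (m := 2 ^ E)) ?expn_gt0 // -mulnA -expnD big_distrl /=.
  apply: (@leq_trans (\sum_(i < size Z) #|X| ^ k.+1)).
    apply: leq_sum => i _; rewrite cardsX cardsT -mulnA expnS leq_mul2l.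
    by case: (VP i) => _ ->; rewrite orbT.
  by rewrite sum_nat_const card_ord mulnC leq_mul2l leZ orbT.
rewrite -(card_imset _ inj_split).
have le1 := leq_trans (subset_leq_card sub) (leq_card_setU _ _).
have leP' : (#|P| * 2 ^ m.+1 <= #|X| ^ k.+1)%N.
  by apply: leq_trans leP _; rewrite !cardsT card_ffun card_ord expnS.
rewrite -(leq_pmul2l (m := 2)) // mulnCA -expnS.
apply: leq_trans (leq_mul (leq_trans le1 (leq_add (leqnn _) (leq_card_bigcup _))) (leqnn _)) _.
by rewrite mulnDl mul2n -addnn leq_add.
Qed.

End Multipartite.

(** * Equitable partitions *)

Section Equitable.
Local Open Scope nat_scope.

Lemma card_interval n a b : b <= n -> #|[set i : 'I_n | a <= i < b]| = b - a.
Proof.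
move=> le_bn; rewrite -sum1dep_card big_mkcond /=.
suff -> : \sum_(i < n) (if a <= i < b then 1 else 0) = minn b n - minn a n by lia.
elim: n {le_bn} => [|n IHn]; first by rewrite big_ord0; lia.
by rewrite big_ord_recr /= IHn; case: ifP; lia.
Qed.

(** The fiber is an interval between two consecutive values of the ceiling of
    j n / K. *)
Lemma card_quotient_fiber n K j : 0 < K -> 0 < n -> j < K ->
  n %/ K <= #|[set i : 'I_n | i * K %/ n == j]| <= (n %/ K).+1.
Proof.
move=> K_gt0 n_gt0 ltjK.
have ceilE c i : (c <= i * K) = ((c + K.-1) %/ K <= i).
  by rewrite -[RHS]ltnS ltn_divLR // mulSn; lia.
have -> : [set i : 'I_n | i * K %/ n == j] =
    [set i : 'I_n | (j * n + K.-1) %/ K <= i < (j * n + n + K.-1) %/ K].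
  apply/setP => i; rewrite !inE -ceilE ltnNge -ceilE -ltnNge.
  rewrite eqn_leq -ltnS ltn_divLR // leq_divRL // mulSn [n + _]addnC.
  by rewrite andbC.
rewrite card_interval.
  rewrite addnAC [X in X - _]divnD // -addnA addKn.
  by case: (K <= _); rewrite /= ?addn0 ?addn1 ?leqnn ?leqnSn.
rewrite -ltnS ltn_divLR // mulSn.
have : (j * n + n <= K * n) by rewrite addnC -mulSn leq_mul2r ltjK orbT.
by lia.
Qed.

Lemma monotone_rank n (cl : 'I_n -> nat) :
  exists2 r : 'I_n -> 'I_n, bijective r & forall x y, r x < r y -> cl x <= cl y.
Proof.
pose le x y := cl x <= cl y; pose s := sort le (enum 'I_n).
have mem_s x : x \in s by rewrite mem_sort mem_enum.
have size_s : size s = n by rewrite size_sort size_enum_ord.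
have lt_index x : index x s < n.
  by rewrite -[X in _ < X]size_s index_mem.
exists (fun x => Ordinal (lt_index x)).
  apply: injF_bij => x y /(congr1 val) /= eq_index.
  by rewrite -(nth_index x (mem_s x)) eq_index nth_index.
have le_total : total le by move=> x y; apply: leq_total.
move=> x y; apply: (sorted_ltn_index _ (sort_sorted le_total _)) => //.
by move=> a b c; apply: leq_trans.
Qed.

(** Sort the points by cl and send the point of rank i to the interval
    floor (i K / n).  If an interval is not contained in a class, then cl
    increases strictly within it; taking in each such interval a point where cl
    is not maximal gives strictly increasing values of cl, of which there are at
    most s. *)
Lemma equitable_refinement n K s (cl : 'I_n -> nat) :
    0 < K <= n -> (forall x, cl x < s) ->
  exists part : 'I_n -> 'I_K,
    (forall j, n %/ K <= #|[set x | part x == j]| <= (n %/ K).+1) /\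
    #|[set j | [exists x, [exists y,
         [&& part x == j, part y == j & cl x != cl y]]]]| <= s.
Proof.
case/andP => K_gt0 leKn lt_cl; have n_gt0 := leq_trans K_gt0 leKn.
have [r bij_r mono_r] := monotone_rank cl.
have lt_part (x : 'I_n) : r x * K %/ n < K.
  by rewrite ltn_divLR // mulnC ltn_mul2l K_gt0 /=.
exists (fun x => Ordinal (lt_part x)); split.
  move=> j; have := card_quotient_fiber K_gt0 n_gt0 (ltn_ord j).
  rewrite -(on_card_preimset (onW_bij _ bij_r)).
  suff -> : r @^-1: [set i : 'I_n | i * K %/ n == j] =
            [set x | Ordinal (lt_part x) == j] by [].
  by apply/setP => x; rewrite !inE.
set bad := [set j | _].
have /fin_all_exists[f fP] (j : 'I_K) : exists x, j \in bad ->
    Ordinal (lt_part x) = j /\ exists y, Ordinal (lt_part y) = j /\ cl x < cl y.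
  have [jbad|_] := boolP (j \in bad); last by exists (Ordinal n_gt0).
  move: jbad; rewrite inE => /existsP[x /existsP[y /and3P[/eqP xj /eqP yj]]].
  case: ltngtP => // lt_cl' _; [exists x|exists y] => _; split => //.
    by exists y.
  by exists x.
have mono_f : {in bad &, forall j j' : 'I_K, j < j' -> cl (f j) < cl (f j')}.
  move=> j j' /fP[_ [y [yj lt_y]]] /fP[fj' _] lt_jj'.
  apply: leq_trans lt_y _; apply: mono_r; rewrite ltnNge.
  apply: contraL lt_jj' => le_r; rewrite -leqNgt -fj' -yj /=.
  by rewrite leq_div2r // leq_mul2r le_r orbT.
rewrite -(card_ord s) -(card_in_imset (f := fun j => Ordinal (lt_cl (f j))) (D := bad)).
  exact: max_card.
move=> j j' jb jb' /(congr1 val) /= eq_cl; apply/val_inj/eqP; case: ltngtP => //.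
  by move/(mono_f _ _ jb jb'); rewrite eq_cl ltnn.
by move/(mono_f _ _ jb' jb); rewrite eq_cl ltnn.
Qed.

End Equitable.

Section SlotCounting.
Local Open Scope nat_scope.
Variables (k : nat) (X : finType).

(** Double counting: exchanging a with the value of x in slot l is an involution
    on the pairs (x, a). *)
Lemma card_slot_bounded (S : {set {ffun 'I_k -> X}}) l s :
  (forall x, #|[set a | update x l a \in S]| <= s) -> #|X| * #|S| <= s * #|X| ^ k.
Proof.
move=> leS; pose swap (z : {ffun 'I_k -> X} * X) := (update z.1 l z.2, z.1 l).
have swapK : involutive swap.
  case=> x a; rewrite /swap /= ffunE eqxx; congr (_, _).
  by apply/ffunP => l'; rewrite !ffunE; case: eqP => [->|].
rewrite -[#|X|]cardsT mulnC -cardsX -(on_card_preimset (onW_bij _ (inv_bij swapK))).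
rewrite (card_fibers _ fst).
apply: (@leq_trans (\sum_(x : {ffun 'I_k -> X}) s)).
  apply: leq_sum => x _; apply: leq_trans (leS x).
  have inj : injective (fun a : X => (x, a)) by move=> a b [].
  rewrite -(card_imset _ inj); apply/subset_leq_card/subsetP => -[y a].
  rewrite !inE andbT /= => /andP[yS /eqP eq_yx]; apply/imsetP; exists a => //.
    by rewrite inE -eq_yx.
  by rewrite eq_yx.
by rewrite sum_nat_const card_ffun card_ord cardsT mulnC.
Qed.

Lemma card_slot_in l (B : {set X}) :
  #|X| * #|[set x : {ffun 'I_k -> X} | x l \in B]| <= #|B| * #|X| ^ k.
Proof.
apply: (@card_slot_bounded _ l) => x; apply/subset_leq_card/subsetP => a.
by rewrite !inE ffunE eqxx.
Qed.

Lemma card_slot_eq l l' : l != l' ->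
  #|X| * #|[set x : {ffun 'I_k -> X} | x l == x l']| <= #|X| ^ k.
Proof.
move=> neq; rewrite -[X in _ <= X]mul1n; apply: (@card_slot_bounded _ l) => x.
rewrite -(cards1 (x l')); apply/subset_leq_card/subsetP => a.
by rewrite !inE !ffunE eqxx eq_sym (eq_sym l') (negPf neq) eq_sym.
Qed.

Lemma card_not_injective :
  #|X| * #|[set x : {ffun 'I_k -> X} | ~~ injectiveb x]| <= k * k * #|X| ^ k.
Proof.
pose S (p : 'I_k * 'I_k) := [set x : {ffun 'I_k -> X} | (p.1 != p.2) && (x p.1 == x p.2)].
have sub : [set x : {ffun 'I_k -> X} | ~~ injectiveb x] \subset \bigcup_p S p.
  apply/subsetP => x; rewrite inE => /injectivePn[l [l' neq eqx]].
  by apply/bigcupP; exists (l, l') => //; rewrite inE neq eqx /=.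
apply: leq_trans (leq_mul (leqnn _) (subset_leq_card sub)) _.
apply: leq_trans (leq_mul (leqnn _) (leq_card_bigcup _)) _.
have -> : k * k = #|{: 'I_k * 'I_k}| by rewrite card_prod card_ord.
rewrite big_distrr /= -sum_nat_const; apply: leq_sum => p _.
have [eqp|neq] := eqVneq p.1 p.2.
  rewrite (_ : S p = set0) ?cards0 ?muln0 //.
  by apply/setP => x; rewrite !inE eqp eqxx.
apply: leq_trans (card_slot_eq neq); rewrite leq_mul2l; apply/orP; right.
by apply/subset_leq_card/subsetP => x; rewrite !inE => /andP[].
Qed.

End SlotCounting.

(** * Hypergraphs determined by signs of forms *)

Section RegularPartition.
Local Open Scope nat_scope.

Lemma equitable_fibers (V : finType) K (f : V -> 'I_K) q : 0 < q ->
  (forall j, q <= #|[set x | f x == j]| <= q.+1) ->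
  equitable_partition (fun j => [set x | f x == j]).
Proof.
move=> q_gt0 sizes.
have nonempty j : exists x, f x = j.
  have /card_gt0P[x] : 0 < #|[set x | f x == j]|.
    by case/andP: (sizes j) => /(leq_trans q_gt0).
  by rewrite inE => /eqP; exists x.
split=> [|j j' /setP eq_fib|j j'].
- apply/and3P; split.
  + apply/eqP/setP => x; rewrite inE; apply/bigcupP.
    by exists [set x' | f x' == f x]; [apply/imsetP; exists (f x)|rewrite inE].
  + apply/trivIsetP => _ _ /imsetP[j _ ->] /imsetP[j' _ ->] neq.
    rewrite disjoint_subset; apply/subsetP => x; rewrite !inE => /eqP->.
    by apply: contra neq => /eqP->.
  + apply/imsetP => -[j _] /setP e0; have [x fx] := nonempty j.
    by have := e0 x; rewrite !inE fx eqxx.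
- by have [x fx] := nonempty j; have := eq_fib x; rewrite !inE fx eqxx => /esym/eqP.
- case/andP: (sizes j) => _ /leq_trans; apply.
  by rewrite addn1 ltnS; case/andP: (sizes j').
Qed.

Lemma homogeneous_constant k (V : finType) (H : hypergraph k V) (A : 'I_k -> {set V}) :
  {in family A &, forall x y, (x \in edge_rel H) = (y \in edge_rel H)} ->
  homogeneous H A.
Proof.
move=> const; rewrite /homogeneous; have [//|/=] := boolP (_ \subset _).
case/subsetPn => x xA xH; rewrite disjoint_subset; apply/subsetP => y yA.
by rewrite inE -(const x y).
Qed.

(** The boxes over different tuples of parts are disjoint and have at least q^k
    elements each. *)
Lemma card_box_family k (V : finType) K (f : V -> 'I_K) q (S : {set {ffun 'I_k -> V}}) :
  (forall j, q <= #|[set x | f x == j]|) ->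
  #|[set i : {ffun 'I_k -> 'I_K} |
      [forall x, (x \in family (fun l => [set v | f v == i l])) ==> (x \in S)]]| * q ^ k <= #|S|.
Proof.
move=> leq_fib; pose ff (x : {ffun 'I_k -> V}) := [ffun l => f (x l)].
have := markov S ff (q ^ k) 1; rewrite !mul1n; apply: leq_trans.
rewrite leq_mul2r; apply/orP; right; apply/subset_leq_card/subsetP => i.
rewrite !inE mul1n => /forallP allS.
apply: (@leq_trans #|family (fun l => [set v | f v == i l])|).
  rewrite card_family -[X in q ^ X](card_ord k) -prod_nat_const foldrE big_map big_enum /=.
  by apply: leq_prod => l _.
apply/subset_leq_card/subsetP => x xi; rewrite inE (implyP (allS x) xi).
apply/eqP/ffunP => l; rewrite ffunE.
by have /familyP/(_ l) := xi; rewrite inE => /eqP.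
Qed.

Lemma exponent_bound m k N M e :
  k + (k.+1 + M * (N + e * (m + 1 + k + N).+1 + 1)) + m.+1
    <= (2 * k + 2 + M * (N + 1 + e * (2 + k + N))) * m.+1.
Proof.
have le1 : (m + 1 + k + N).+1 <= (2 + k + N) * m.+1.
  have : m <= (2 + k + N) * m by rewrite leq_pmull.
  by rewrite mulnS; lia.
have le2 : N + e * (m + 1 + k + N).+1 + 1 <= (N + 1 + e * (2 + k + N)) * m.+1.
  rewrite addnAC mulnDl leq_add //; first by rewrite leq_pmulr.
  by rewrite -mulnA leq_mul2l le1 orbT.
rewrite mulnDl addnA addnAC leq_add //; first by rewrite mulnS; lia.
by rewrite -mulnA leq_mul2l le2 orbT.
Qed.

(** With fewer than K points, singletons do.  Otherwise a tuple of parts can fail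
    to be homogeneous in three ways: two of its parts coincide, one of them
    meets two cells, or its box is mixed for some form.  A box whose parts are
    within cells is either free of mixed tuples or made of them, so that boxes
    of the third kind are counted by mixed tuples: their
    proportion is at most 2^k N 2^-m', as the parts have at least n / (2 K)
    elements.  The other two kinds have proportion at most k (k + s) / K, where s
    bounds the number of cells; this decides the choice of K. *)
Lemma sign_determined_regularity (R : realFieldType) M k N : 0 < k -> exists c,
  forall m n (u : 'I_n -> nat -> R) (I : finType) (F : I -> {ffun 'I_k -> 'I_n} -> R)
         (H : hypergraph k 'I_n),
  #|I| <= N -> (forall i, slotwise M u (F i)) ->
  (forall x y : {ffun 'I_k -> 'I_n}, injective x -> injective y ->
     (forall i, (0 <= F i x)%R = (0 <= F i y)%R) ->
     (x \in edge_rel H) = (y \in edge_rel H)) ->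
  exists K (Q : 'I_K -> {set 'I_n}),
    [/\ equitable_partition Q, K <= 2 ^ (c * m.+1)
      & #|[set i : {ffun 'I_k -> 'I_K} | ~~ homogeneous H (fun l => Q (i l))]| * 2 ^ m
        <= K ^ k].
Proof.
move=> k_gt0; have [e multi] := multipartite_regularity R M k.
pose c := 2 * k + 2 + M * (N + 1 + e * (2 + k + N)).
exists c => m n u I F H leIN slotF detH; set K := 2 ^ (c * m.+1).
have K_gt0 : 0 < K by rewrite expn_gt0.
have [lt_nK|le_Kn] := ltnP n K.
  exists n, (fun j => [set x | x == j]); split; last 1 first.
  - rewrite (_ : finset _ = set0) ?cards0 //.
    apply/setP => i; rewrite in_set0 inE; apply/negbTE; rewrite negbK.
    apply: homogeneous_constant => x y /familyP xi /familyP yi.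
    suff -> : x = y by [].
    by apply/ffunP => l; have := xi l; have := yi l; rewrite !inE => /eqP-> /eqP->.
  - apply: (@equitable_fibers _ _ id 1) => // j.
    by rewrite (_ : [set x | _] = [set j]) ?cards1 //; apply/setP => x; rewrite !inE.
  - exact: ltnW.
(* 2 ^ 1 for the other two kinds of tuples, 2 ^ k for boxes, 2 ^ N for the forms *)
pose m' := m + 1 + k + N.
have /fin_all_exists[V VP] i := multi m' _ u (F i) (slotF i).
pose W := flatten [seq V i | i <- enum I].
have leW : size W <= N * 2 ^ (e * m'.+1).
  apply: leq_trans (size_flatten_le (m := 2 ^ (e * m'.+1)) _) _.
    by move=> i _; case: (VP i).
  by rewrite -cardE leq_mul2r leIN orbT.
pose pats := [set pattern M W (u x) | x : 'I_n].
pose s := (size W).+1 ^ M.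
have s_gt0 : 0 < s by rewrite expn_gt0.
have le_pats : #|pats| <= s by apply: card_patterns.
have in_pats x : pattern M W (u x) \in enum pats by rewrite mem_enum imset_f.
pose cl x := index (pattern M W (u x)) (enum pats).
have lt_cl x : cl x < s by apply: leq_trans le_pats; rewrite cardE index_mem.
have same_cl x y : cl x = cl y -> same_side M W (u x) (u y).
  move=> eq_cl; rewrite same_side_pattern.
  by rewrite -[X in X == _](nth_index (pattern M W (u y)) (in_pats x)) -/(cl x) eq_cl
    nth_index.
have [|part [sizes le_bad]] := @equitable_refinement n K s cl _ lt_cl.
  by rewrite K_gt0.
set bad := [set j | _] in le_bad.
pose q := n %/ K; have q_gt0 : 0 < q by rewrite divn_gt0.
pose Q j := [set x | part x == j].
exists K, Q; split => //; first exact: (equitable_fibers q_gt0).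
pose box (i : {ffun 'I_k -> 'I_K}) := family (fun l => Q (i l)).
pose NI := [set i : {ffun 'I_k -> 'I_K} | ~~ injectiveb i].
pose B l := [set i : {ffun 'I_k -> 'I_K} | i l \in bad].
pose T a := [set i : {ffun 'I_k -> 'I_K} |
              [forall x, (x \in box i) ==> (x \in mixed_tuples M u (V a) (F a))]].
set nonhom := [set i | _].
have sub : nonhom \subset NI :|: \bigcup_l B l :|: \bigcup_a T a.
  apply/subsetP => i inonhom; apply: contraLR inonhom.
  rewrite in_setU in_setU !negb_or -andbA => /and3P[iNI iB iT].
  rewrite inE negbK; have /injectiveP inj_i : injectiveb i by move: iNI; rewrite inE negbK.
  have part_box x l : x \in box i -> part (x l) = i l.
    by move/familyP/(_ l); rewrite inE => /eqP.
  have inj_box x : x \in box i -> injective x.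
    move=> xi l l' eqx; apply: inj_i.
    by rewrite -(part_box x l xi) -(part_box x l' xi) eqx.
  have cl_box x y l : x \in box i -> y \in box i -> cl (x l) = cl (y l).
    move=> xi yi; apply/eqP; apply: contraNT iB => neq.
    apply/bigcupP; exists l => //; rewrite !inE.
    apply/existsP; exists (x l); apply/existsP; exists (y l).
    by rewrite (part_box x) // (part_box y) // !eqxx.
  apply: homogeneous_constant => x y xi yi.
  apply: detH => [||a]; [exact: inj_box|exact: inj_box|].
  have : i \notin T a by apply: contra iT => iTa; apply/bigcupP; exists a.
  rewrite inE => /forallPn[z]; rewrite negb_imply => /andP[zi zmix].
  have zE w : w \in box i -> (0 <= F a z)%R = (0 <= F a w)%R.
    move=> wi; apply/eqP; apply: contraNT zmix => neq; apply/mixedP; split => //.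
    exists w; split => //; apply/forallP => l.
    apply: (@same_side_flatten _ M _ V (enum I) a); first by rewrite mem_enum.
    exact/same_cl/cl_box.
  by rewrite -zE // -zE.
have leT a : #|T a| * 2 ^ m' <= 2 ^ k * K ^ k.
  have le_box : #|T a| * q ^ k <= #|mixed_tuples M u (V a) (F a)|.
    by apply: (@card_box_family k _ K part q) => j; case/andP: (sizes j).
  have [_ le_mix] := VP a; rewrite card_ord in le_mix.
  have le_n : n <= 2 * K * q.
    have lt_mod : n %% K < K by rewrite ltn_mod.
    rewrite (divn_eq n K) -/q mul2n -addnn mulnDl mulnC leq_add2l.
    by rewrite (leq_trans (ltnW lt_mod)) // leq_pmulr.
  rewrite -(leq_pmul2r (m := q ^ k)) ?expn_gt0 ?q_gt0 // -!expnMn mulnAC.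
  apply: leq_trans (leq_trans le_mix (leq_expn k le_n)).
  by rewrite leq_mul2r le_box orbT.
have le_sumT : (\sum_a #|T a|) * 2 ^ m.+1 <= K ^ k.
  rewrite -(leq_pmul2l (m := 2 ^ (k + N))) ?expn_gt0 // mulnCA -expnD.
  rewrite (_ : k + N + m.+1 = m'); last by rewrite /m'; lia.
  rewrite big_distrl /= [2 ^ (k + N)]expnD.
  apply: (@leq_trans (\sum_(a : I) 2 ^ k * K ^ k)).
    by apply: leq_sum => a _; apply: leT.
  rewrite sum_nat_const mulnA leq_mul2r mulnC leq_mul2l.
  by rewrite (leq_trans leIN) ?orbT // ltnW // ltn_expl.
have le_other : (#|NI| + \sum_l #|B l|) * 2 ^ m.+1 <= K ^ k.
  have leB l : K * #|B l| <= s * K ^ k.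
    have := card_slot_in l bad; rewrite card_ord => /leq_trans; apply.
    by rewrite leq_mul2r le_bad orbT.
  have leNI : K * #|NI| <= k * k * K ^ k.
    by have := card_not_injective k 'I_K; rewrite card_ord.
  have le_sumB : K * (\sum_l #|B l|) <= k * s * K ^ k.
    rewrite big_distrr /=; apply: (@leq_trans (\sum_(l < k) s * K ^ k)).
      by apply: leq_sum => l _; apply: leB.
    by rewrite sum_nat_const card_ord mulnA.
  have leK : k * (k + s) * 2 ^ m.+1 <= K.
    have le_size : (size W).+1 <= 2 ^ (N + e * m'.+1 + 1).
      apply: (@leq_trans (2 ^ (N + e * m'.+1)).+1).
        by rewrite ltnS (leq_trans leW) // expnD leq_mul2r ltnW ?orbT // ltn_expl.
      by rewrite addn1 expnS mul2n -addnn -addn1 leq_add2l expn_gt0.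
    have le_s : s <= 2 ^ (M * (N + e * m'.+1 + 1)).
      by rewrite /s mulnC expnM leq_expn.
    have le_k : k + s <= 2 ^ k.+1 * s.
      have ltk : k < 2 ^ k by rewrite ltn_expl.
      rewrite expnS -mulnA mul2n -addnn leq_add ?leq_pmull ?expn_gt0 //.
      by rewrite (leq_trans (ltnW ltk)) // leq_pmulr.
    apply: (@leq_trans (2 ^ k * (2 ^ k.+1 * 2 ^ (M * (N + e * m'.+1 + 1))) * 2 ^ m.+1)).
      rewrite leq_mul2r; apply/orP; right; apply: leq_mul; first by rewrite ltnW // ltn_expl.
      by apply: leq_trans le_k _; rewrite leq_mul2l le_s orbT.
    rewrite -!expnD leq_exp2l // /c /m'.
    exact: exponent_bound.
  rewrite -(leq_pmul2l (m := k * (k + s))) ?muln_gt0 ?k_gt0 ?addn_gt0 ?k_gt0 //.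
  apply: (@leq_trans (K * (#|NI| + \sum_l #|B l|))).
    by rewrite mulnCA mulnC leq_mul2r leK orbT.
  by rewrite mulnDr mulnDr mulnDl leq_add.
rewrite -(leq_pmul2l (m := 2)) // mulnCA -expnS.
apply: (@leq_trans ((#|NI| + \sum_l #|B l| + \sum_a #|T a|) * 2 ^ m.+1)).
  rewrite leq_mul2r; apply/orP; right; apply: leq_trans (subset_leq_card sub) _.
  apply: leq_trans (leq_card_setU _ _) _; apply: leq_add (leq_card_bigcup _).
  by apply: leq_trans (leq_card_setU _ _) _; rewrite leq_add2l leq_card_bigcup.
by rewrite mulnDl mul2n -addnn leq_add.
Qed.

End RegularPartition.

(** * Semi-algebraic hypergraphs *)

Section Veronese.
Variables (R : realType) (d D : nat).

Definition nmonomials := #|{: 'X_{1..d < D.+1}}|.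

(** The values of all monomials of degree at most D, padded by zeros. *)
Definition veronese (x : 'rV[R]_d) (s : nat) : R :=
  if insub s is Some s' then mmap1 (x 0) (bmnm (enum_val (s' : 'I_nmonomials))) else 0.

Lemma meval_veronese (g : {mpoly R[d]}) : (msize g <= D.+1)%N ->
  exists c, forall x : 'rV[R]_d, g.@[x 0] = dot nmonomials (veronese x) c.
Proof.
move=> leD.
pose c s := if insub s is Some s' then g@_(enum_val (s' : 'I_nmonomials)) else 0.
exists c => x; rewrite {1}(mpolywE leD) rmorph_sum /=.
rewrite (reindex (@enum_val _ {: 'X_{1..d < D.+1}})) /=; last first.
  by apply: onW_bij; exact: enum_val_bij.
apply: eq_bigr => s _; rewrite mevalZ mulrC /veronese /c !valK.
by rewrite mevalX.
Qed.

(** Substituting the coordinates of a point for the indeterminates of slot m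
    restores the value at all points. *)
Lemma eval_slot_poly k (f : {mpoly R[k * d]}) (m : 'I_k) (y : 'I_k -> 'rV[R]_d) q :
  (forall l, y (lift m l) = q l) ->
  eval_points f y = (slot_poly f m q).@[y m 0].
Proof.
move=> yq; rewrite /eval_points /slot_poly comp_mpoly_meval.
apply: meval_eq => a; rewrite tnth_mktuple.
case/mxvec_indexP: a => l s; rewrite !mxvecE !mxE.
by case: unliftP => [l'|] ->; rewrite ?mevalC ?mevalXU ?yq.
Qed.
End Veronese.

Section Forms.
Variables (R : realType) (k d D n : nat) (p : 'I_n -> 'rV[R]_d).

Lemma slotwise_eval_points (f : {mpoly R[k * d]}) (pi : 'S_k) :
  (forall m q, (msize (slot_poly f m q) <= D.+1)%N) ->
  slotwise (nmonomials d D) (fun a => veronese D (p a))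
    (fun x : {ffun 'I_k -> 'I_n} => eval_points f (fun l => p (x (pi l)))).
Proof.
move=> degf l x; pose m := (pi^-1)%g l.
pose q l' := p (x (pi (lift m l'))).
have [c cP] := meval_veronese (degf m q); exists c => a.
rewrite (@eval_slot_poly _ _ _ f m _ q).
  by rewrite ffunE permKV eqxx cP.
move=> l'; rewrite ffunE (_ : _ == l = false) //.
by apply/negbTE; rewrite (canF_eq (permK pi)) eq_sym neq_lift.
Qed.

(** Both sides are invariant under permuting the entries of x: the left one
    because edges are sets, the right one because it quantifies over all
    permutations.  So x may be assumed increasing. *)
Lemma edge_sign_determined (t : nat) (H : hypergraph k 'I_n)
    (f : 'I_t -> {mpoly R[k * d]}) (Phi : t.-tuple bool -> bool) :
  (forall i : {ffun 'I_k -> 'I_n},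
     {homo i : a b / (a < b)%N} ->
     i \in edge_rel H <->
     forall pi : 'S_k,
       Phi [tuple 0 <= eval_points (f j) (fun l => p (i (pi l))) | j < t]) ->
  forall x : {ffun 'I_k -> 'I_n}, injective x ->
    (x \in edge_rel H) =
    [forall pi : 'S_k,
       Phi [tuple 0 <= eval_points (f j) (fun l => p (x (pi l))) | j < t]].
Proof.
move=> edgeP x inj_x.
have [r [r' rK r'K] mono_r] := monotone_rank (fun l => x l : nat).
pose sigma := perm (can_inj r'K).
pose y : {ffun 'I_k -> 'I_n} := [ffun l => x (sigma l)].
have incr_y : {homo y : a b / (a < b)%N}.
  move=> a b lt_ab; rewrite !ffunE !permE ltn_neqAle mono_r ?r'K // andbT.
  by rewrite val_eqE (inj_eq inj_x) (inj_eq (can_inj r'K)) neq_ltn lt_ab.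
have -> : (x \in edge_rel H) = (y \in edge_rel H).
  rewrite !inE (_ : [set y l | l : 'I_k] = [set x l | l : 'I_k]) //; apply/setP => v.
  apply/imsetP/imsetP => -[l _ ->]; first by exists (sigma l); rewrite ?ffunE.
  by exists (r l) => //; rewrite ffunE permE rK.
have tupleE (pi : 'S_k) :
    [tuple 0 <= eval_points (f j) (fun l => p (y (pi l))) | j < t] =
    [tuple 0 <= eval_points (f j) (fun l => p (x ((pi * sigma)%g l))) | j < t].
  apply/eq_from_tnth => j; rewrite !tnth_mktuple; congr (0 <= _).
  rewrite /eval_points; congr (meval (fun_of_matrix (mxvec _) 0) _).
  by apply/matrixP => l s; rewrite !mxE ffunE permM.
apply/idP/forallP => [/(edgeP y incr_y) all_pi pi|all_pi].
  by rewrite -(mulgKV sigma pi) -tupleE; apply: all_pi.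
by apply/(edgeP y incr_y) => pi; rewrite tupleE; apply: all_pi.
Qed.

End Forms.

(** For the least m with 2^m >= 1 / eps, one has 2^(m+1) < 4 / eps, and
    4 < 1 / eps^2. *)
Lemma dyadic_scale (R : realType) (eps : R) : 0 < eps -> eps < 1 / 2 ->
  exists m, 1 <= eps * (2 ^ m)%:R /\ (2 ^ m.+1)%:R <= (1 / eps) ^+ 3.
Proof.
move=> eps_gt0 eps_lt; have y2 : 2 < 1 / eps.
  by rewrite ltr_pdivlMr // mulrC -ltr_pdivlMr //.
have ex_m : exists m, 1 / eps <= (2 ^ m)%:R :> R.
  exists (Num.bound (1 / eps)); apply/ltW.
  apply: lt_le_trans (archi_boundP _) _; first by lra.
  by rewrite ler_nat ltnW // ltn_expl.
case: (ex_minnP ex_m) => m le_m min_m; exists m; split.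
  by rewrite mulrC -ler_pdivrMr.
case: m => [|m] in le_m min_m *; first by move: le_m; rewrite expn0; lra.
have lt_m : (2 ^ m)%:R < 1 / eps.
  by rewrite ltNge; apply/negP => /min_m; rewrite ltnn.
rewrite !expnS !natrM !exprS expr0; nra.
Qed.

Theorem theorem1p3 (R : realType) (k d t D : nat)
    (hk : (0 < k)%N) (hd : (0 < d)%N) (ht : (0 < t)%N) (hD : (0 < D)%N) :
  exists c : R, 0 < c /\
    forall eps : R, 0 < eps -> eps < 1 / 2 ->
    forall (n : nat) (p : 'I_n -> 'rV[R]_d) (H : hypergraph k 'I_n),
      injective p ->
      semi_algebraic t D p H ->
      exists (K : nat) (Q : 'I_K -> {set 'I_n}),
        [/\ equitable_partition Q,
            K%:R <= (1 / eps) `^ c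
          & #|[set i : {ffun 'I_k -> 'I_K} |
                ~~ homogeneous H (fun l => Q (i l))]|%:R
              <= eps * #|{ffun 'I_k -> 'I_K}|%:R].
Proof.
have [c regular] := sign_determined_regularity R (nmonomials d D) #|{: 'I_t * 'S_k}| hk.
exists (3 * c).+1%:R; split; first by rewrite ltr0n.
move=> eps eps_gt0 eps_lt n p H _ [f [Phi [edgeP degf]]].
have [m [le_m le_y]] := dyadic_scale eps_gt0 eps_lt.
pose F (i : 'I_t * 'S_k) (x : {ffun 'I_k -> 'I_n}) :=
  eval_points (f i.1) (fun l => p (x (i.2 l))).
have [|i|x y inj_x inj_y eqF|K [Q [eqQ leK leN]]] :=
    regular m n (fun a => veronese D (p a)) _ F H.
- by [].
- exact/slotwise_eval_points/degf.
- have edgeE := @edge_sign_determined R k d n p t H f Phi edgeP.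
  rewrite !edgeE //; apply: eq_forallb => pi; congr (Phi _).
  by apply/eq_from_tnth => j; rewrite !tnth_mktuple; apply: (eqF (j, pi)).
exists K, Q; split=> //.
  have y_ge1 : 1 <= 1 / eps by rewrite ler_pdivlMr // mul1r; lra.
  rewrite powR_mulrn; last by lra.
  apply: (@le_trans _ _ ((1 / eps) ^+ (3 * c))); last by rewrite ler_weXn2l.
  rewrite exprM; apply: (@le_trans _ _ ((2 ^ m.+1)%:R ^+ c)).
    by rewrite -natrX -expnM mulnC ler_nat.
  by apply: lerXn2r => //; rewrite nnegrE ?exprn_ge0 //; lra.
rewrite card_ffun !card_ord.
set bad := #|_| in leN *.
apply: (@le_trans _ _ (eps * (2 ^ m)%:R * bad%:R)); first by rewrite ler_peMl.
by rewrite -mulrA ler_pM2l // -natrM ler_nat mulnC.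
Qed.
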